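(* Let $(P_k)_{k\ge 1}$ be a collection of Markov kernels on a measurable space $(\mathsf{X},\mathcal{B}(\mathsf{X}))$. Assume there exist a set $C\in\mathcal{B}(\mathsf{X})$, a measurable function $V:\mathsf{X}\to[1,\infty)$, a concave, non-decreasing and differentiable function $\phi:[1,\infty)\to(0,\infty)$ with $\lim_{t\to\infty}\phi'(t)=0$, probability measures $(\nu_k)_{k\ge 1}$ on $(\mathsf{X},\mathcal{B}(\mathsf{X}))$ and constants $\epsilon_\nu,\epsilon_b\in(0,1)$, $b_V,c_V<\infty$ such that for all $k\ge 1$, \begin{align*} &P_kV(x)\le V(x)-\phi(V(x))+b_V\mathbb{I}\{x\in C\}\quad\text{for all }x\in\mathsf{X},\\ &P_k(x,\cdot)\ge \epsilon_\nu\nu_k(\cdot)\quad\text{for all }x\in C,\\ &\inf_{x\notin C}\phi(V(x))\ge b_V(1-\epsilon_b)^{-1}\quad\text{and}\quad \sup_{x\in C}V(x)\le c_V . \end{align*} Define $H_\phi:[1,\infty)\to[0,\infty)$ and $r:\mathbb{N}\to[1,\infty)$ by $$H_\phi(t)=\int_1^t\frac{\mathrm{d}s}{\phi(s)},\qquad r(n)=\frac{\phi\big(H_\phi^{-1}(\epsilon_b n)\big)}{\phi(1)} .$$ Then there exists a constant $c\in[0,\infty)$, depending on $b_V,c_V,\epsilon_b,\epsilon_\nu$ and $\phi$ only, such that for any pair of Young functions $\Psi_1,\Psi_2$, for any measurable $f:\mathsf{X}\to\mathbb{R}$ satisfying $\|f\|_W=\sup_{x\in\mathsf{X}}|f(x)|/W(x)<\infty$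 with $W(x)=\Psi_2\big(\phi(V(x))/\phi(1)\big)$, and for all $x,x'\in\mathsf{X}$, $$\sum_{n\ge 0}\Psi_1\big(r(n)\big)\,\big|P^{(n)}f(x)-P^{(n)}f(x')\big|\le c\,\big(V(x)+V(x')-1\big)\,\|f\|_W .$$ Moreover, the constant $c$ can be given as $$c=\frac{2}{\epsilon_b\phi(1)}\bigg[2+\frac{\bar b}{\epsilon_\nu}+c_*\bar b\,r(1)\bigg(1+\frac{r(1)}{\epsilon_b\phi(1)}\bigg)\bigg],$$ where \begin{align*} \bar b&=2b_V+\epsilon_b\phi(1), & c_*&=\sum_{j=1}^\infty(1-\epsilon_\nu)^{j-1}\prod_{k=1}^{j-1}(1+\delta_kM_1),\\ \delta_k&=\epsilon_b\,\phi'\big(H_\phi^{-1}(\epsilon_b k)\big), & M_1&=r(1)\bigg[1+\frac{2r(1)}{\epsilon_b\phi(1)}\bigg(\frac{b_V+c_V}{1-\epsilon_\nu}-1\bigg)\bigg]. \end{align*}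
   Context: Notation: $\mathbb{N}=\{0,1,2,\dots\}$; $\mathbb{I}\{\cdot\}$ is the indicator; for a Markov kernel $P$ and measurable $f$, $Pf(x)=\int P(x,\mathrm{d}y)f(y)$; for kernels $P,Q$, $PQ(x,A)=\int P(x,\mathrm{d}y)Q(y,A)$. $P^{(n)}=P_1P_2\cdots P_n$ for $n\ge1$, and $P^{(0)}(x,A)=\mathbb{I}\{x\in A\}$. Empty products equal 1. Young functions: non-decreasing functions $\Psi_1,\Psi_2:[1,\infty)\to(0,\infty)$ are a pair of Young functions if $\Psi_1(x)\Psi_2(y)\le x+y$ for all $x,y\ge1$. *)

(* Defs.v *)
From HB Require Import structures.
From mathcomp Require Import all_boot all_order all_algebra.
From mathcomp Require Import all_classical all_reals all_analysis.
Set Implicit Arguments.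
Unset Strict Implicit.
Unset Printing Implicit Defensive.
Import Order.TTheory GRing.Theory Num.Theory.
Import numFieldNormedType.Exports.

Local Open Scope classical_set_scope.
Local Open Scope ring_scope.
Local Open Scope ereal_scope.

(* Functions on [1, +oo[ are represented by total functions R -> R of which
   only the values on [1, +oo[ matter; a sequence indexed by k >= 1 is
   represented by a function on nat whose value at 0 is ignored. *)

Section markov_kernels.
Context d (T : measurableType d) (R : realType).

(* kprod P n = P_1 P_2 ... P_n. It is a probability kernel; the type only says
   sub-probability because that is the structure the library provides on the
   composite mkcomp_noparam k1 k2 : x, A |-> \int[k1 x]_y k2 y A. *)
Fixpoint kprod (P : nat -> R.-pker T ~> T) (n : nat) : R.-spker T ~> T :=
  if n is m.+1 then mkcomp_noparam (kprod P m) (P m.+1)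
  else kdirac (@measurable_id _ T setT).

Definition wnorm (W f : T -> R) : \bar R :=
  ereal_sup [set (`|f x| / W x)%:E | x in [set: T]].

End markov_kernels.

Local Close Scope ereal_scope.

Section rates.
Context {R : realType}.
Implicit Types (phi Psi : R -> R) (bV cV eb enu : R).

Definition young_pair Psi1 Psi2 :=
  [/\ {in `[1, +oo[ &, {homo Psi1 : x y / x <= y}},
      {in `[1, +oo[ &, {homo Psi2 : x y / x <= y}},
      {in `[1, +oo[, forall x, 0 < Psi1 x /\ 0 < Psi2 x} &
      {in `[1, +oo[ &, forall x y, Psi1 x * Psi2 y <= x + y}].

(* At the endpoint 1 the derivative is the right one. *)
Definition differentiable_1y phi :=
  {in `]1, +oo[, forall t, derivable phi t 1} /\
  cvg ((fun h => h^-1 * (phi (1 + h) - phi 1)) @ 0^'+).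

Definition concave_1y phi :=
  convex_function (`[1, +oo[%classic : set R) (fun t => - phi t).

Definition Hphi phi (t : R) : R :=
  \int[lebesgue_measure]_(s in `[1, t]) (phi s)^-1.

(* Inverse of Hphi restricted to [1, +oo[; the default value 1 is used only
   outside the image of Hphi. *)
Definition Hphi_inv phi : R -> R := 'pinv_(fun=> 1) `[1, +oo[ (Hphi phi).

Definition rate phi eb (n : nat) : R :=
  phi (Hphi_inv phi (eb * n%:R)) / phi 1.

Definition bbar phi bV eb : R := 2 * bV + eb * phi 1.

Definition delta phi eb (k : nat) : R :=
  eb * derive1 phi (Hphi_inv phi (eb * k%:R)).

Definition M1 phi bV cV eb enu : R :=
  let r1 := rate phi eb 1 in
  r1 * (1 + 2 * r1 / (eb * phi 1) * ((bV + cV) / (1 - enu) - 1)).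

(* Valued in \bar R: convergence of the series is not presupposed. *)
Definition cstar phi bV cV eb enu : \bar R :=
  (\sum_(1 <= j <oo)
    ((1 - enu) ^+ j.-1 *
     \prod_(1 <= k < j) (1 + delta phi eb k * M1 phi bV cV eb enu))%:E)%E.

Definition cbound phi bV cV eb enu : \bar R :=
  let r1 := rate phi eb 1 in
  let b := bbar phi bV eb in
  ((2 / (eb * phi 1))%:E *
   ((2 + b / enu)%:E +
    cstar phi bV cV eb enu * (b * r1 * (1 + r1 / (eb * phi 1)))%:E))%E.

End rates.

(* Main.v *)
Require Import Defs.
From mathcomp Require Import all_boot all_order all_algebra.
From mathcomp Require Import all_classical all_reals all_analysis.
From mathcomp Require Import measurable_realfun.
From mathcomp Require Import ring lra.
Import Order.TTheory GRing.Theory Num.Theory.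
Import numFieldNormedType.Exports.
Local Open Scope classical_set_scope.
Local Open Scope ring_scope.

(** The proof is a coupling argument in which no coupling is built.

    Fix a horizon N and weights a_i = Psi1(r(i)) or -Psi1(r(i)), and let S_k be
    the sum over i from k to N-1 of a_i E[f(X_i) | X_k = .]. Then
    S_k = a_k f + P_(k+1) S_(k+1), and for suitable signs S_0(x) - S_0(x') is a
    partial sum of the series to be bounded. It suffices to bound the
    oscillation S_k(y) - S_k(y'), for all y, y', by backward induction on k.
    A bound on the oscillation of S that is affine in
    v = V(y) + V(y') - 1 is turned by the next kernel into a bound with the
    same coefficients, evaluated at the mean of v after one step
    ([one_step_contraction]); when y and y' are both in C the minorisation
    removes a fraction enu of the mass. This is what a coupling would give
    after one step, but it only uses one-variable integrals: the product
    kernel and its measurability never enter. A concave function of v is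
    below each of its tangents, so it may replace an affine bound.

    The problem is thus reduced to finding a concave function of v
    ([potential]) that, at each time k, dominates its own one-step image plus
    the cost 2 r(k) + (phi(V y) + phi(V y')) / phi(1) which the Young
    inequality Psi1(r(k)) W <= r(k) + phi(V) / phi(1) leaves to be summed.
    With y the inverse of H and h_k(v) = y(H(v) + eb k) - y(eb k), it combines
    three terms:
    - h_k pays for the sum of the r(k): one step lowers it in mean by at least
      eb phi(1) r(k) ([shifted_flow_drift]), up to a rise of at most
      2 bV r(k+1) in C x C;
    - those rises are paid by c_k (r(k+1) + rate_growth k r(1) / (eb phi(1)) h_k),
      an upper bound for the expected sum of r(n+1) over the visits of C x C to
      come; c_k ([visits]) obeys the recursion which generates the partial sums of
      cstar;
    - v + bbar / enu pays for the sum of the phi(V), the number of visits of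
      C x C before the merging of the two chains being geometric.

    The inequalities on h_k come from the flow of dy/dt = phi(y): since phi is
    concave, t |-> phi(y(t)) is log-concave ([phi_inv_log_concave]), hence each
    h_k is concave with slope at most r(k), and r(k+1) / r(k) decreases. *)

(** * Two facts on real functions *)

Lemma locally_lipschitz_continuous {R : realType} (f : R -> R) :
  (forall B, exists K, forall s t, s <= t -> t <= B ->
     `|f t - f s| <= K * (t - s)) -> continuous f.
Proof.
move=> lipf x; have [K hK] := lipf (x + 1).
apply/cvgrPdist_le => e e0.
have K1 : 0 < `|K| + 1 by rewrite ltr_pwDr.
have hK' s t : s <= t -> t <= x + 1 -> `|f t - f s| <= (`|K| + 1) * (t - s).
  move=> st tx; apply: le_trans (hK _ _ st tx) _; apply: ler_wpM2r; first lra.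
  by rewrite (le_trans (ler_norm K))// lerDl.
have lip t : t <= x + 1 -> `|f x - f t| <= (`|K| + 1) * `|x - t|.
  move=> tx; have [tx0|tx0] := leP t x.
    by rewrite (ger0_norm (_ : 0 <= x - t)) ?subr_ge0//; apply: hK' => //; lra.
  rewrite distrC (distrC x) (ger0_norm (_ : 0 <= t - x)) ?subr_ge0//; last lra.
  by apply: hK' => //; lra.
near=> t.
apply: le_trans (lip t _) _.
  have : `|t - x| < 1 by near: t; apply: cvgr_distC_lt => //; exact: cvg_id.
  by move=> /ltr_normlP[]; lra.
rewrite mulrC -ler_pdivlMr//; near: t.
by apply: cvgr_dist_le; [exact: cvg_id|rewrite divr_gt0].
Unshelve. all: end_near. Qed.

(** Composing with [Num.max 0] states continuity on [0, +oo[ as continuity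
    on the whole line, which spares one-sided limits at 0. *)
Lemma derive_ge0_le {R : realType} (f df : R -> R) (a b : R) :
  0 <= a -> a <= b -> continuous (fun t : R => f (Num.max 0 t)) ->
  (forall u, a < u -> u < b -> is_derive u 1 f (df u)) ->
  (forall u, a < u -> u < b -> 0 <= df u) -> f a <= f b.
Proof.
move=> a0; rewrite le_eqVlt => /predU1P[->//|ab] cf drv df0.
have cf' : {within `[a, b], continuous f}.
  apply: (@subspace_eq_continuous _ _ _ (fun t : R => f (Num.max 0 t))).
    by move=> x; rewrite inE/= in_itv/= => /andP[ax _]; rewrite max_r// (le_trans a0).
  exact: continuous_subspaceT.
have [|c] := MVT ab (df := df) _ cf'.
  by move=> x; rewrite in_itv/= => /andP[ax xb]; exact: drv.
rewrite in_itv/= => /andP[ac cb] e.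
by rewrite -subr_ge0 e mulr_ge0 ?df0// subr_ge0 ltW.
Qed.

(** * Integrals against kernels, and the one-step contraction *)

Section kernels.
Context {d} {T : measurableType d} {R : realType}.
Local Open Scope ereal_scope.

Lemma ge0_integral_mkcomp (k1 k2 : R.-spker T ~> T) (x : T) (f : T -> \bar R) :
  (forall z, 0 <= f z) -> measurable_fun [set: T] f ->
  \int[mkcomp_noparam k1 k2 x]_z f z = \int[k1 x]_y \int[k2 y]_z f z.
Proof.
move=> f0 mf.
rewrite (@eq_measure_integral _ _ _ _ (kcomp k1 (kernel.kernel_snd k2) x))//.
by rewrite integral_kcomp.
Qed.

Lemma ge0_le_integral_minor (mu nu : {measure set T -> \bar R}) (e : R)
    (f : T -> \bar R) : (0 <= e)%R ->
  (forall A, measurable A -> e%:E * nu A <= mu A) ->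
  (forall z, 0 <= f z) -> measurable_fun [set: T] f ->
  e%:E * \int[nu]_z f z <= \int[mu]_z f z.
Proof.
move=> e0 numu f0 mf.
rewrite -[e%:E]/((NngNum e0)%:num%:E) -ge0_integral_mscale//.
exact: ge0_le_measure_integral.
Qed.

Local Close Scope ereal_scope.

Lemma integrable_cst1 (mu : {measure set T -> \bar R}) a :
  mu [set: T] = 1%E -> mu.-integrable [set: T] (EFin \o cst a).
Proof.
move=> mu1; apply/integrableP; split; first exact/measurable_EFinP/measurable_cst.
by rewrite [X in (X < _)%E](integral_cst mu measurableT `|a|%:E) mu1 mule1 ltry.
Qed.

Lemma Rintegral_ge (mu : {measure set T -> \bar R}) (V : T -> R) c :
  mu [set: T] = 1%E -> mu.-integrable [set: T] (EFin \o V) ->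
  (forall x, c <= V x) -> c <= \int[mu]_x V x.
Proof.
move=> mu1 iV cV; have ic := integrable_cst1 _ c mu1.
have := le_Rintegral measurableT ic iV (fun z _ => cV z).
by rewrite Rintegral_cst// mu1 mulr1.
Qed.

Lemma integrable_scale (mu : {measure set T -> \bar R}) (V : T -> R) b :
  mu.-integrable [set: T] (EFin \o V) ->
  mu.-integrable [set: T] (EFin \o (fun x => b * V x)).
Proof. by move=> iV; exact: (integrableZl _ b iV). Qed.

Lemma integrable_add (mu : {measure set T -> \bar R}) (V S : T -> R) :
  mu.-integrable [set: T] (EFin \o V) -> mu.-integrable [set: T] (EFin \o S) ->
  mu.-integrable [set: T] (EFin \o (fun x => V x + S x)).
Proof. by move=> iV iS; exact: (integrableD _ iV iS). Qed.

Lemma integrable_affine (mu : {measure set T -> \bar R}) (V S : T -> R) a b c :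
  mu [set: T] = 1%E -> mu.-integrable [set: T] (EFin \o V) ->
  mu.-integrable [set: T] (EFin \o S) ->
  mu.-integrable [set: T] (EFin \o (fun x => a + b * V x + c * S x)).
Proof.
move=> mu1 iV iS; apply: integrable_add; last exact: integrable_scale.
by apply: integrable_add; [exact: integrable_cst1|exact: integrable_scale].
Qed.

Lemma Rintegral_affine (mu : {measure set T -> \bar R}) (V S : T -> R) a b c :
  mu [set: T] = 1%E -> mu.-integrable [set: T] (EFin \o V) ->
  mu.-integrable [set: T] (EFin \o S) ->
  \int[mu]_x (a + b * V x + c * S x) = a + b * \int[mu]_x V x + c * \int[mu]_x S x.
Proof.
move=> mu1 iV iS.
have ia := integrable_cst1 _ a mu1.
have ib := integrable_scale _ _ b iV.
have ic := integrable_scale _ _ c iS.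
have iab := integrable_add _ _ _ ia ib.
rewrite RintegralD// RintegralD// !RintegralZl// Rintegral_cst// mu1.
by rewrite mulr1.
Qed.

(** A nonnegative function integrates to something nonnegative against
    [mu - e nu]; that difference never has to be made into a measure. *)
Lemma minor_affine (mu nu : {measure set T -> \bar R}) (V S : T -> R) e a b c :
  mu [set: T] = 1%E -> nu [set: T] = 1%E -> 0 <= e ->
  (forall A, measurable A -> (e%:E * nu A <= mu A)%E) ->
  mu.-integrable [set: T] (EFin \o V) -> mu.-integrable [set: T] (EFin \o S) ->
  nu.-integrable [set: T] (EFin \o V) -> nu.-integrable [set: T] (EFin \o S) ->
  (forall y, 0 <= a + b * V y + c * S y) ->
  0 <= a * (1 - e) + b * (\int[mu]_x V x - e * \int[nu]_x V x) +
       c * (\int[mu]_x S x - e * \int[nu]_x S x).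
Proof.
move=> mu1 nu1 e0 numu iV iS iV' iS' f0.
have mf : measurable_fun [set: T] (fun y => a + b * V y + c * S y).
  have mV := measurable_int _ iV; have mS := measurable_int _ iS.
  move/measurable_EFinP in mV; move/measurable_EFinP in mS.
  by apply: measurable_funD; [apply: measurable_funD|]; rewrite //; exact: measurable_funM.
have finint (m : {measure set T -> \bar R}) : m [set: T] = 1%E ->
    m.-integrable [set: T] (EFin \o V) -> m.-integrable [set: T] (EFin \o S) ->
    (\int[m]_y (a + b * V y + c * S y)%:E)%E =
    (a + b * \int[m]_x V x + c * \int[m]_x S x)%:E.
  move=> m1 iV1 iS1; rewrite -Rintegral_affine// /Rintegral fineK//.
  by apply: integrable_fin_num => //; exact: integrable_affine.
have := ge0_le_integral_minor _ _ e (fun y => (a + b * V y + c * S y)%:E) e0 numu.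
have mfE : measurable_fun [set: T] (fun y => (a + b * V y + c * S y)%:E).
  exact/measurable_EFinP.
move=> /(_ f0 mfE).
rewrite !finint// -EFinM lee_fin; lra.
Qed.

(** The nonnegative function
    (y, y') |-> p + q (V y + V y' - 1) - S y + S y' is integrated against
    [mu - e nu] in y, then against [mu' - e nu] in y'. The [nu]-integrals of S
    cancel, and one factor [1 - e] too many is divided out. *)
Lemma one_step_contraction (mu mu' nu : {measure set T -> \bar R})
    (V S : T -> R) e p q :
  mu [set: T] = 1%E -> mu' [set: T] = 1%E -> nu [set: T] = 1%E -> 0 <= e -> e < 1 ->
  (forall A, measurable A -> (e%:E * nu A <= mu A)%E) ->
  (forall A, measurable A -> (e%:E * nu A <= mu' A)%E) ->
  mu.-integrable [set: T] (EFin \o V) -> mu.-integrable [set: T] (EFin \o S) ->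
  mu'.-integrable [set: T] (EFin \o V) -> mu'.-integrable [set: T] (EFin \o S) ->
  nu.-integrable [set: T] (EFin \o V) -> nu.-integrable [set: T] (EFin \o S) ->
  (forall y y', S y - S y' <= p + q * (V y + V y' - 1)) ->
  \int[mu]_x S x - \int[mu']_x S x <= (1 - e) * p +
   q * (\int[mu]_x V x + \int[mu']_x V x - 2 * e * \int[nu]_x V x - (1 - e)).
Proof.
move=> mu1 mu1' nu1 e0 e1 numu numu' iV iS iV' iS' iVn iSn hS.
have h1 y' := minor_affine mu nu V S e (p + q * (V y' - 1) + S y') q (-1)
  mu1 nu1 e0 numu iV iS iVn iSn.
set I := \int[mu]_x V x in h1 *; set J := \int[mu]_x S x in h1 *.
set N := \int[nu]_x V x in h1 *; set L := \int[nu]_x S x in h1 *.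
have h2 := minor_affine mu' nu V S e
  ((p - q) * (1 - e) + q * (I - e * N) - (J - e * L)) (q * (1 - e)) (1 - e)
  mu1' nu1 e0 numu' iV' iS' iVn iSn.
set I' := \int[mu']_x V x in h2 *; set J' := \int[mu']_x S x in h2 *.
rewrite -/N -/L in h2.
have e10 : 0 < 1 - e by rewrite subr_gt0.
rewrite -subr_ge0 -(pmulr_rge0 _ e10).
rewrite [X in 0 <= X](_ : _ = ((p - q) * (1 - e) + q * (I - e * N) - (J - e * L)) *
  (1 - e) + q * (1 - e) * (I' - e * N) + (1 - e) * (J' - e * L)); last by ring.
apply: h2 => y'.
rewrite [X in 0 <= X](_ : _ = (p + q * (V y' - 1) + S y') * (1 - e) + q * (I - e * N) +
  -1 * (J - e * L)); last by ring.
by apply: h1 => y; have := hS y y'; lra.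
Qed.

(** * Functions dominated by V along the chain *)

Section chain.
Variables (P : nat -> R.-pker T ~> T) (V : T -> R) (b : R).
Hypothesis mV : measurable_fun [set: T] V.
Hypothesis V_ge1 : forall x, 1 <= V x.
Hypothesis b_ge0 : 0 <= b.
Hypothesis PV_le : forall k x, (1 <= k)%N ->
  (\int[P k x]_y (V y)%:E <= (V x + b)%:E)%E.

(** The class of functions which is stable under the kernels and on which
    all integrals below are finite. *)
Definition dominated (S : T -> R) := measurable_fun [set: T] S /\
  exists2 K, 0 <= K & forall y, `|S y| <= K * V y.

Let V_ge0 x : 0 <= V x. Proof. exact: le_trans (V_ge1 x). Qed.

Let mVE : measurable_fun [set: T] (EFin \o V).
Proof. exact/measurable_EFinP. Qed.

Lemma dominated_integrable (mu : {measure set T -> \bar R}) S :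
  mu.-integrable [set: T] (EFin \o V) -> dominated S ->
  mu.-integrable [set: T] (EFin \o S).
Proof.
move=> iV [mS [K K0 hS]].
apply: le_integrable (integrable_scale _ _ K iV) => //; first exact/measurable_EFinP.
move=> x _ /=; rewrite lee_fin (le_trans (hS x))//.
by rewrite ger0_norm// mulr_ge0.
Qed.

Lemma dominatedV : dominated V.
Proof. by split=> //; exists 1 => // y; rewrite mul1r ger0_norm. Qed.

Lemma integrable_V_of_le (mu : {measure set T -> \bar R}) c :
  (\int[mu]_y (V y)%:E <= c%:E)%E -> mu.-integrable [set: T] (EFin \o V).
Proof.
move=> hV; apply/integrableP; split => //.
under eq_integral do rewrite /= ger0_norm//.
by apply: le_lt_trans hV _; rewrite ltry.
Qed.

Lemma integrable_V k x : (1 <= k)%N -> (P k x).-integrable [set: T] (EFin \o V).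
Proof. by move=> k1; exact: integrable_V_of_le (PV_le k x k1). Qed.

Definition transition k (S : T -> R) x := \int[P k x]_y S y.

Lemma transitionE k S x : (1 <= k)%N -> dominated S ->
  (\int[P k x]_y (S y)%:E)%E = (transition k S x)%:E.
Proof.
move=> k1 dS; rewrite /transition /Rintegral fineK//.
by apply: integrable_fin_num => //; exact: dominated_integrable (integrable_V _ _ k1) dS.
Qed.

(** Adding a multiple of V makes a dominated function nonnegative: this is how
    facts on integrals of nonnegative functions reach signed ones. *)
Lemma dominated_shift (S : T -> R) (K : R) : 0 <= K -> measurable_fun [set: T] S ->
  (forall y, `|S y| <= K * V y) -> dominated (fun y => S y + K * V y) /\
  forall y, 0 <= S y + K * V y.
Proof.
move=> K0 mS hS; split; last first.
  by move=> y; have /ler_normlP[] := hS y; lra.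
split; first by apply: measurable_funD => //; exact: measurable_funM.
exists (K + K); first exact: addr_ge0.
move=> y; rewrite (le_trans (ler_normD _ _))// mulrDl lerD// ger0_norm//.
by rewrite mulr_ge0.
Qed.

Lemma Rintegral_shift (mu : {measure set T -> \bar R}) (S : T -> R) K :
  mu.-integrable [set: T] (EFin \o V) -> dominated S ->
  \int[mu]_y (S y + K * V y) = \int[mu]_y S y + K * \int[mu]_y V y.
Proof.
move=> iV dS; have iS := dominated_integrable _ _ iV dS.
by rewrite RintegralD// ?RintegralZl//; exact: integrable_scale.
Qed.

Lemma transition_le k x : (1 <= k)%N -> transition k V x <= V x + b.
Proof. by move=> k1; rewrite -lee_fin -transitionE ?PV_le//; exact: dominatedV. Qed.

Lemma measurable_transition_ge0 k (S : T -> R) : (1 <= k)%N -> measurable_fun [set: T] S ->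
  (forall y, 0 <= S y) -> measurable_fun [set: T] (transition k S).
Proof.
move=> k1 mS S0; apply: measurableT_comp; first exact: fine_measurable.
apply: measurable_fun_integral_kernel; last exact/measurable_EFinP.
  by move=> U mU; exact: measurable_kernel.
by move=> z; rewrite lee_fin.
Qed.

Lemma dominated_transition k S : (1 <= k)%N -> dominated S ->
  dominated (transition k S).
Proof.
move=> k1 dS; have [mS [K K0 hS]] := dS.
have iV x := integrable_V k x k1.
split.
  have [[mSK _] SK0] := dominated_shift _ _ K0 mS hS.
  rewrite (_ : transition k S = (fun x =>
    transition k (fun y => S y + K * V y) x - K * transition k V x)).
    apply: measurable_funB; first exact: measurable_transition_ge0.
    by apply: measurable_funM => //; exact: measurable_transition_ge0.
  by apply/funext => x; rewrite {2}/transition Rintegral_shift// /transition; lra.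
exists (K * (1 + b)); first by rewrite mulr_ge0// addr_ge0.
move=> x; have iS := dominated_integrable _ _ (iV x) dS.
apply: le_trans (le_normr_Rintegral _ iS) _ => //.
apply: (@le_trans _ _ (K * transition k V x)).
  rewrite /transition -RintegralZl//; apply: le_Rintegral => //.
  - exact: integrable_norm iS.
  - exact: integrable_scale.
rewrite -mulrA; apply: ler_wpM2l => //; apply: le_trans (transition_le _ _ k1) _.
have := V_ge1 x; have : 0 <= b * (V x - 1); last lra.
by apply: mulr_ge0 => //; rewrite subr_ge0.
Qed.

Lemma kprod_mass n x : kprod P n x [set: T] = 1%E.
Proof.
elim: n x => [|n IH] x; first by rewrite /= /kdirac diracT.
rewrite /= /mkcomp_noparam /= /kcomp_noparam.
under eq_integral do rewrite prob_kernel.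
by rewrite integral_cst// mul1e.
Qed.

Lemma kprodS_ge0 n x S : dominated S -> (forall y, 0 <= S y) ->
  (\int[kprod P n.+1 x]_y (S y)%:E = \int[kprod P n x]_y (transition n.+1 S y)%:E)%E.
Proof.
move=> dS S0; rewrite ge0_integral_mkcomp.
- by apply: eq_integral => y _; rewrite transitionE.
- by move=> z; rewrite lee_fin.
- by have [mS _] := dS; exact/measurable_EFinP.
Qed.

Lemma kprod_V n x : (\int[kprod P n x]_y (V y)%:E <= (V x + n%:R * b)%:E)%E.
Proof.
elim: n => [|n IH].
  by rewrite mul0r addr0 integral_dirac// diracT mul1e.
have dV := dominatedV.
rewrite kprodS_ge0//; apply: (@le_trans _ _ (\int[kprod P n x]_y ((V y)%:E + b%:E)))%E.
  apply: ge0_le_integral => //.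
  - by move=> y _; rewrite lee_fin Rintegral_ge0.
  - by have [mS _] := dominated_transition n.+1 _ isT dV; exact/measurable_EFinP.
  - by apply: emeasurable_funD => //; exact: measurable_cst.
  - by move=> y _; rewrite -EFinD lee_fin transition_le.
rewrite ge0_integralD//; last by move=> y _; rewrite lee_fin.
rewrite integral_cst// kprod_mass mule1.
rewrite (_ : V x + _ = V x + n%:R * b + b); last by rewrite -natr1; ring.
by rewrite EFinD leeD2r.
Qed.

Lemma kprod_integrable_V n x : (kprod P n x).-integrable [set: T] (EFin \o V).
Proof. exact: integrable_V_of_le (kprod_V n x). Qed.

Lemma kprodS n x S : dominated S ->
  \int[kprod P n.+1 x]_y S y = \int[kprod P n x]_y transition n.+1 S y.
Proof.
move=> dS; have [mS [K K0 hS]] := dS; have dV := dominatedV.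
have [dSK SK0] := dominated_shift _ _ K0 mS hS.
have e1 : \int[kprod P n.+1 x]_y (S y + K * V y) =
    \int[kprod P n x]_y transition n.+1 (fun z => S z + K * V z) y.
  by rewrite /Rintegral kprodS_ge0.
have e2 : \int[kprod P n.+1 x]_y V y = \int[kprod P n x]_y transition n.+1 V y.
  by rewrite /Rintegral kprodS_ge0.
have iVn := kprod_integrable_V n x.
have iT := dominated_integrable _ _ iVn (dominated_transition n.+1 _ isT dS).
have iTV := dominated_integrable _ _ iVn (dominated_transition n.+1 _ isT dV).
have e3 : \int[kprod P n x]_y transition n.+1 (fun z => S z + K * V z) y =
   \int[kprod P n x]_y transition n.+1 S y + K * \int[kprod P n x]_y transition n.+1 V y.
  rewrite -RintegralZl// -RintegralD//; last exact: integrable_scale.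
  apply: eq_Rintegral => y _; rewrite {1}/transition Rintegral_shift//.
  exact: integrable_V.
move: e1; rewrite e3 Rintegral_shift//; last exact: kprod_integrable_V.
by rewrite e2 => /addIr.
Qed.

(** The function written S_k in the introduction, for a sum of [m] terms. *)
Fixpoint backward_sum (a : nat -> R) (f : T -> R) k m : T -> R :=
  if m is m'.+1
  then fun y => a k * f y + transition k.+1 (backward_sum a f k.+1 m') y
  else cst 0.

Lemma dominated_backward_sum a f k m : dominated f -> dominated (backward_sum a f k m).
Proof.
move=> df; have [mf [K K0 hf]] := df; elim: m k => [|m IH] k /=.
  by split; [exact: measurable_cst|exists 0 => // y; rewrite normr0 mul0r].
have [mT [L L0 hL]] := dominated_transition k.+1 _ isT (IH k.+1).
split; first by apply: measurable_funD => //; exact: measurable_funM.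
exists (`|a k| * K + L); first by rewrite addr_ge0// mulr_ge0.
move=> y; rewrite (le_trans (ler_normD _ _))// mulrDl lerD// normrM -mulrA.
by rewrite ler_wpM2l.
Qed.

Lemma kprod_backward_sum a f k m x : dominated f ->
  \int[kprod P k x]_y backward_sum a f k m y =
  \sum_(k <= i < k + m) a i * \int[kprod P i x]_y f y.
Proof.
move=> df; elim: m k => [|m IH] k /=.
  by rewrite addn0 big_geq// Rintegral_cst// mul0r.
have dB := dominated_backward_sum a f k.+1 m df.
have iV := kprod_integrable_V k x.
have iT := dominated_integrable _ _ iV (dominated_transition k.+1 _ isT dB).
have iF := dominated_integrable _ _ iV df.
rewrite RintegralD ?RintegralZl//; last exact: integrable_scale.
by rewrite -kprodS// IH addSnnS big_ltn// -addSnnS leq_addr.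
Qed.

End chain.
End kernels.

(** * The concave function phi *)

Section drift_rate.
Context {R : realType} (phi : R -> R).
Hypothesis phi_concave : concave_1y phi.
Hypothesis phi_ndecr : {in `[1, +oo[ &, {homo phi : s t / s <= t}}.
Hypothesis phi_diff : differentiable_1y phi.
Hypothesis phi_pos : {in `[1, +oo[, forall t, 0 < phi t}.

Let in1y (t : R) : 1 <= t -> t \in `[1, +oo[.
Proof. by rewrite in_itv/= andbT. Qed.

Lemma phi_gt0 t : 1 <= t -> 0 < phi t.
Proof. by move=> /in1y /phi_pos. Qed.

Lemma phi_le s t : 1 <= s -> s <= t -> phi s <= phi t.
Proof. by move=> s1 st; apply: phi_ndecr => //; apply: in1y; lra. Qed.

(** Concavity as the inequality between a point and a chord, cleared of
    denominators. *)
Lemma phi_chord a b c : 1 <= a -> a <= b -> b <= c ->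
  (c - b) * phi a + (b - a) * phi c <= (c - a) * phi b.
Proof.
move=> a1 ab bc; have [ac|ac] := eqVneq a c; first subst c.
  have -> : b = a by lra.
  lra.

have ac0 : 0 < c - a by lra.
have t0 : 0 <= (c - b) / (c - a) by rewrite divr_ge0//; lra.
have t1 : (c - b) / (c - a) <= 1 by rewrite ler_pdivrMr//; lra.
have := @phi_concave (Itv01 t0 t1) a c.
rewrite !inE /= !in_itv/= !andbT => /(_ a1 ltac:(lra)).
rewrite !convRE /= /unstable.onem.
rewrite /conv /= /conv /= /unstable.onem.
have -> : (c - b) / (c - a) * a + (1 - (c - b) / (c - a)) * c = b.
  by field; lra.
have -> : (c - b) / (c - a) * - phi a + (1 - (c - b) / (c - a)) * - phi c =
   - (((c - b) * phi a + (b - a) * phi c) / (c - a)) by field; lra.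
by rewrite lerN2 ler_pdivrMr// [phi b * _]mulrC.
Qed.

(** Both [a] and [b] lie between 1 and [a + b - 1]: add the two chord
    inequalities. *)
Lemma phi_subadd a b : 1 <= a -> 1 <= b ->
  phi (a + b - 1) + phi 1 <= phi a + phi b.
Proof.
move=> a1 b1; have [N0|N0] := eqVneq (a + b - 2) 0.
  have [-> ->] : a = 1 /\ b = 1 by split; lra.
  by rewrite (_ : 1 + 1 - 1 = 1 :> R) ?lexx//; lra.
have N1 : 0 < a + b - 2 by lra.
have ha := @phi_chord 1 a (a + b - 1) ltac:(lra) ltac:(lra) ltac:(lra).
have hb := @phi_chord 1 b (a + b - 1) ltac:(lra) ltac:(lra) ltac:(lra).
rewrite -(ler_pM2l N1); lra.
Qed.

(** The right derivative at 1 is the largest slope of a concave function. *)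
Lemma phi_lipschitz : exists2 K, 0 <= K &
  forall s t, 1 <= s -> s <= t -> phi t - phi s <= K * (t - s).
Proof.
have [_ /cvg_ex[/= K cK]] := phi_diff.
have slope1 t : 1 <= t -> phi t - phi 1 <= K * (t - 1).
  rewrite le_eqVlt => /predU1P[<-|t1]; first lra.
  rewrite -ler_pdivrMr ?subr_gt0//.
  apply: (cvgr_to_ge cK); near=> h.
  have h0 : 0 < h by near: h; exact: nbhs_right_gt.
  have ht : h < t - 1 by near: h; apply: nbhs_right_lt; lra.
  have := @phi_chord 1 (1 + h) t ltac:(lra) ltac:(lra) ltac:(lra).
  move=> hc; rewrite [leRHS]mulrC ler_pdivlMr// mulrAC ler_pdivrMr ?subr_gt0//; lra.
exists K.
  have := slope1 2 ltac:(lra); have := phi_le 1 2 ltac:(lra) ltac:(lra); lra.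
move=> s t s1 st; have [->|s_neq1] := eqVneq s 1; first by apply: slope1; lra.
have := slope1 s s1; have := phi_chord 1 s t ltac:(lra) s1 st.
move=> h1 h2; rewrite -(@ler_pM2l _ (s - 1)); last lra.
nra.
Unshelve. all: end_near. Qed.

(** Slopes of chords from [t] are monotone, and the derivative is their limit
    from the left and from the right. *)
Lemma phi_tangent t u : 1 < t -> 1 <= u ->
  phi u <= phi t + derive1 phi t * (u - t).
Proof.
move=> t1 u1; have [-> |ut] := eqVneq u t; first lra.
have dphi : h^-1 * (phi (h + t) - phi t) @[h --> 0^'] --> derive1 phi t.
  have := phi_diff.1 t ltac:(by rewrite in_itv/= andbT).
  rewrite /derivable /derive1 => /cvgP.
  by under eq_fun do rewrite /= [_ *: 1]mulr1.
have [tu|tu] := leP t u.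
  have {}tu : t < u by lra.
  rewrite -lerBlDl -ler_pdivrMr ?subr_gt0//.
  apply: (cvgr_to_ge (cvg_dnbhs_at_right dphi)); near=> h.
  have h0 : 0 < h by near: h; exact: nbhs_right_gt.
  have ht : h < u - t by near: h; apply: nbhs_right_lt; lra.
  have := @phi_chord t (h + t) u ltac:(lra) ltac:(lra) ltac:(lra).
  move=> hc; rewrite [leRHS]mulrC ler_pdivlMr// mulrAC ler_pdivrMr ?subr_gt0//; lra.
rewrite -lerBlDl -lerN2 -mulrN opprB -ler_pdivlMr ?subr_gt0//.
apply: (cvgr_to_le (cvg_dnbhs_at_left dphi)); near=> h.
have h0 : h < 0 by near: h; exact: nbhs_left_lt.
have ht : u - t < h by near: h; apply: nbhs_left_gt; lra.
have := @phi_chord u (h + t) t ltac:(lra) ltac:(lra) ltac:(lra).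
move=> hc; rewrite ler_pdivlMr ?subr_gt0// -mulrA.
rewrite ler_ndivrMl//; lra.
Unshelve. all: end_near. Qed.

Lemma phi'_ge0 t : 1 < t -> 0 <= derive1 phi t.
Proof.
move=> t1; have := phi_tangent _ (t + 1) t1 ltac:(lra).
have := phi_le t (t + 1) ltac:(lra) ltac:(lra); lra.
Qed.

Lemma phi'_le s t : 1 < s -> s <= t -> derive1 phi t <= derive1 phi s.
Proof.
move=> s1; rewrite le_eqVlt => /predU1P[->//|st].
have h1 := phi_tangent t s ltac:(lra) ltac:(lra).
have h2 := phi_tangent _ t s1 ltac:(lra).
rewrite -(ler_pM2r (_ : 0 < t - s)) ?subr_gt0//; lra.
Qed.

(** phi extended by a constant below 1, so that its continuity is a statement on
    the whole line. *)
Let phi1 (t : R) := phi (Num.max 1 t).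

Let phi1E t : 1 <= t -> phi1 t = phi t.
Proof. by move=> t1; rewrite /phi1 max_r. Qed.

Lemma phi_max_continuous : continuous phi1.
Proof.
have [K K0 lipK] := phi_lipschitz.
apply: locally_lipschitz_continuous => B; exists K => s t st _.
have st1 : Num.max 1 s <= Num.max 1 t by rewrite ge_max !le_max lexx st orbT.
have s1 : 1 <= Num.max 1 s by rewrite le_max lexx.
rewrite /phi1 ger0_norm; last by rewrite subr_ge0 phi_le.
apply: le_trans (lipK _ _ s1 st1) _; apply: ler_wpM2l => //.
have [t1|t1] := leP 1 t; have [s1'|s1'] := leP 1 s; lra.
Qed.

Let phi1_gt0 t : 0 < phi1 t.
Proof. by apply: phi_gt0; rewrite le_max lexx. Qed.

(** * The primitive H of 1/phi and its inverse *)

Notation H := (Hphi phi).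

(** Monotonicity of phi under the integral. Everything that is needed of H
    and of its inverse, derivatives included, follows from these two bounds
    and the continuity of phi. *)
Lemma Hphi_diff w u : 1 <= w -> w <= u ->
  (u - w) / phi u <= H u - H w <= (u - w) / phi w.
Proof.
move=> w1 wu.
have HE t : H t = \int[lebesgue_measure]_(s in `[1, t]) (phi1 s)^-1.
  apply: eq_Rintegral => s; rewrite inE/= in_itv/= => /andP[s1 _].
  by rewrite phi1E.
have intV : lebesgue_measure.-integrable `[1, u] (EFin \o (fun s => (phi1 s)^-1)).
  apply: continuous_compact_integrable; first exact: segment_compact.
  apply: continuous_subspaceT => x; apply: cvgV; first by rewrite gt_eqF.
  exact: phi_max_continuous.
have intV' : lebesgue_measure.-integrable `]w, u] (EFin \o (fun s => (phi1 s)^-1)).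
  by apply: integrableS intV => //; apply: subset_itvr; rewrite bnd_simp.
have intc (c : R) : lebesgue_measure.-integrable `]w, u] (EFin \o (fun s => c)).
  have icc : lebesgue_measure.-integrable `[w, u] (EFin \o (fun s : R => c)).
    apply: continuous_compact_integrable; first exact: segment_compact.
    by apply: continuous_subspaceT => x; exact: cvg_cst.
  by apply: integrableS icc => //; apply: subset_itvr; rewrite bnd_simp.
have cstE (c : R) : \int[lebesgue_measure]_(s in `]w, u]) c = (u - w) * c.
  rewrite Rintegral_cst//= lebesgue_measure_itv/= lte_fin mulrC.
  by case: ltP => //= uw; rewrite (_ : u = w) ?subrr//; lra.
have -> : H u - H w = \int[lebesgue_measure]_(s in `]w, u]) (phi1 s)^-1.
  by rewrite !HE Rintegral_itvB// bnd_simp.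
rewrite -!cstE; apply/andP; split; apply: le_Rintegral => //= s;
  rewrite in_itv/= => /andP[ws su]; rewrite phi1E ?lef_pV2 ?posrE ?phi_gt0 ?phi_le//; lra.
Qed.

Lemma Hphi1 : H 1 = 0.
Proof. by rewrite /Hphi set_itv1 Rintegral_set1. Qed.

Lemma Hphi_lt w u : 1 <= w -> w < u -> H w < H u.
Proof.
move=> w1 wu; have /andP[h _] := Hphi_diff _ _ w1 (ltW wu).
rewrite -subr_gt0; apply: lt_le_trans h.
by rewrite divr_gt0 ?subr_gt0// phi_gt0//; lra.
Qed.

Lemma Hphi_le w u : 1 <= w -> w <= u -> H w <= H u.
Proof. by move=> w1; rewrite le_eqVlt => /predU1P[->//|/(Hphi_lt _ _ w1)/ltW]. Qed.

Lemma Hphi_ge0 t : 1 <= t -> 0 <= H t.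
Proof. by move=> t1; rewrite -Hphi1 Hphi_le. Qed.

Lemma Hphi_inj : {in `[1, +oo[ &, injective H}.
Proof.
move=> s t; rewrite !in_itv/= !andbT => s1 t1 e.
have [st|st|//] := ltgtP s t; first by have := Hphi_lt _ _ s1 st; rewrite e ltxx.
by have := Hphi_lt _ _ t1 st; rewrite e ltxx.
Qed.

(** H is unbounded because phi grows at most linearly: doubling [t] adds at
    least a fixed [eta] to H. *)
Lemma Hphi_surj a : 0 <= a -> exists2 v, 1 <= v & H v = a.
Proof.
move=> a0; have [K K0 lipK] := phi_lipschitz.
have p1 : 0 < phi 1 by exact: phi_gt0.
pose eta := (phi 1 + 2 * K)^-1.
have eta0 : 0 < eta by rewrite invr_gt0; lra.
have Hdbl t : 1 <= t -> H t + eta <= H (2 * t).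
  move=> t1; have /andP[h _] := Hphi_diff t (2 * t) t1 ltac:(lra).
  rewrite -lerBrDl; apply: le_trans h.
  have p2t : phi (2 * t) <= phi 1 + K * (2 * t - 1).
    by have := lipK 1 (2 * t) ltac:(lra) ltac:(lra); lra.
  have p2t0 : 0 < phi (2 * t) by apply: phi_gt0; lra.
  rewrite ler_pdivlMr// mulrC ler_pdivrMr; last lra.
  have : phi 1 <= phi 1 * t by rewrite ler_peMr// ltW.
  lra.
have n1 n : 1 <= 2 ^+ n :> R by apply: exprn_ege1; rewrite ler1n.
have H2n n : n%:R * eta <= H (2 ^+ n).
  elim: n => [|n IH]; first by rewrite mul0r expr0 Hphi1.
  have := Hdbl (2 ^+ n) (n1 n).
  rewrite -exprS -[n.+1%:R]natr1 mulrDl mul1r => h.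
  by rewrite (le_trans _ h)// lerD2r.
pose n := Num.bound (a / eta).
have an : a <= H (2 ^+ n).
  apply: le_trans (H2n n); rewrite -ler_pdivrMr//.
  have := archi_boundP (divr_ge0 a0 (ltW eta0)); rewrite -/n; exact: ltW.
have cH : continuous (fun t : R => H (Num.max 1 t)).
  apply: locally_lipschitz_continuous => B; exists (phi 1)^-1 => s t st _.
  have st1 : Num.max 1 s <= Num.max 1 t by rewrite ge_max !le_max lexx st orbT.
  have s1 : 1 <= Num.max 1 s by rewrite le_max lexx.
  rewrite ger0_norm; last by rewrite subr_ge0 Hphi_le.
  have /andP[_ h] := Hphi_diff _ _ s1 st1; apply: le_trans h _.
  rewrite mulrC ler_pM//.
  - by rewrite invr_ge0 ltW// phi_gt0.
  - by rewrite subr_ge0.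
  - by rewrite lef_pV2 ?posrE ?phi_gt0// phi_le.
  - by have [t1|t1] := leP 1 t; have [s1'|s1'] := leP 1 s; lra.
have wcH : {within `[1, 2 ^+ n], continuous (fun t : R => H (Num.max 1 t))}.
  exact: continuous_subspaceT.
have [|c c1 <-] := IVT (v := a) (n1 n) wcH.
  by rewrite (max_r (n1 n)) maxxx Hphi1 min_l ?max_r ?Hphi_ge0// a0 an.
move: c1; rewrite in_itv/= => /andP[c1 _].
by exists c => //; rewrite max_r.
Qed.

Notation y := (Hphi_inv phi).

Lemma Hphi_invP t : 0 <= t -> 1 <= y t /\ H (y t) = t.
Proof.
move=> /Hphi_surj[v v1 <-]; rewrite /Hphi_inv pinvKV ?inE/= ?in_itv/= ?andbT//.
by move=> s u; rewrite !inE; exact: Hphi_inj.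
Qed.

Lemma Hphi_inv_ge1 t : 0 <= t -> 1 <= y t.
Proof. by move/Hphi_invP => []. Qed.

Lemma Hphi_invK t : 0 <= t -> H (y t) = t.
Proof. by move/Hphi_invP => []. Qed.

Lemma HphiK v : 1 <= v -> y (H v) = v.
Proof.
move=> v1; apply: Hphi_inj; rewrite ?Hphi_invK ?Hphi_ge0//.
  by rewrite in_itv/= Hphi_inv_ge1// Hphi_ge0.
by rewrite in_itv/= v1.
Qed.

Lemma Hphi_inv0 : y 0 = 1.
Proof. by rewrite -Hphi1 HphiK. Qed.

Lemma Hphi_inv_le a b : 0 <= a -> a <= b -> y a <= y b.
Proof.
move=> a0 ab; rewrite leNgt; apply/negP => /(Hphi_lt _ _ (Hphi_inv_ge1 _ (le_trans a0 ab))).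
by rewrite !Hphi_invK// ?(le_trans a0)// ltNge ab.
Qed.

Lemma Hphi_inv_gt1 t : 0 < t -> 1 < y t.
Proof.
move=> t0; rewrite lt_neqAle Hphi_inv_ge1 ?ltW// andbT; apply/eqP => e.
by move: (t0); rewrite -[t in 0 < t]Hphi_invK ?ltW// -e Hphi1 ltxx.
Qed.

Let g (t : R) := phi (y t).

Let g_gt0 t : 0 <= t -> 0 < g t.
Proof. by move=> t0; apply: phi_gt0; exact: Hphi_inv_ge1. Qed.

Let g_le a b : 0 <= a -> a <= b -> g a <= g b.
Proof. by move=> a0 ab; apply: phi_le; [exact: Hphi_inv_ge1|exact: Hphi_inv_le]. Qed.

(** The integrated form of the equation y' = phi(y). *)
Lemma Hphi_inv_diff a b : 0 <= a -> a <= b ->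
  (b - a) * phi (y a) <= y b - y a <= (b - a) * phi (y b).
Proof.
move=> a0 ab; have b0 := le_trans a0 ab.
have := Hphi_diff _ _ (Hphi_inv_ge1 _ a0) (Hphi_inv_le _ _ a0 ab).
rewrite !Hphi_invK// ler_pdivrMr ?g_gt0// ler_pdivlMr ?g_gt0//.
by rewrite andbC.
Qed.

(** [y] and [g] extended by constants to the negative numbers, for the same
    reason as [phi1]. *)
Let yy (t : R) := y (Num.max 0 t).
Let gg (t : R) := g (Num.max 0 t).

Let maxr0 (t : R) : 0 <= Num.max 0 t. Proof. by rewrite le_max lexx. Qed.

Let yy_continuous : continuous yy.
Proof.
apply: locally_lipschitz_continuous => B; exists (gg B) => s t st tB.
have st0 : Num.max 0 s <= Num.max 0 t by rewrite ge_max !le_max lexx st orbT.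
have tB0 : Num.max 0 t <= Num.max 0 B by rewrite ge_max !le_max lexx tB orbT.
have /andP[_ h] := Hphi_inv_diff _ _ (maxr0 s) st0.
rewrite ger0_norm; last by rewrite subr_ge0 Hphi_inv_le.
apply: le_trans h _; rewrite mulrC ler_pM//.
- by rewrite ltW// g_gt0.
- by rewrite subr_ge0.
- exact: g_le.
- by have [t1|t1] := leP 0 t; have [s1'|s1'] := leP 0 s; lra.
Qed.

Let gg_continuous : continuous gg.
Proof.
have -> : gg = phi1 \o yy.
  by apply/funext => t; rewrite /gg /g /= phi1E// Hphi_inv_ge1.
move=> t; apply: continuous_comp; first exact: yy_continuous.
exact: phi_max_continuous.
Qed.

(** The difference quotient lies between phi(y(t)) and phi(y(t + h)), and
    phi o y is continuous. *)
Lemma is_derive_Hphi_inv (t : R) : 0 < t -> is_derive t 1 y (phi (y t)).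
Proof.
move=> t0.
suff : h^-1 * (y (h + t) - y t) @[h --> 0^'] --> g t.
  move=> cy; have cy' : h^-1 *: ((y \o shift t) (h *: (1 : R)) - y t) @[h --> 0^'] --> g t.
    by under eq_fun do rewrite /= [_ *: 1]mulr1.
  by apply: DeriveDef; [exact: cvgP cy'|exact: cvg_lim cy'].
have cg : gg (h + t) @[h --> 0^'] --> g t.
  rewrite (_ : g t = gg (0 + t)); last by rewrite add0r /gg max_r// ltW.
  apply: cvg_within_filter.
  apply: (@continuous_comp _ _ _ (fun h => h + t) gg); last exact: gg_continuous.
  by apply: cvgD; [exact: cvg_id|exact: cvg_cst].
apply/cvgrPdist_le => e e0.
have /cvgrPdist_le/(_ e e0) := cg.
apply: filterS2 (_ : \forall h \near 0^', h != 0 /\ - t < h).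
  move=> h [h0 ht]; rewrite /gg max_r; last lra; apply: le_trans.
  have [hp|hn] := ltP 0 h.
    have /andP[h1 h2] := Hphi_inv_diff t (h + t) ltac:(lra) ltac:(lra).
    have q1 : g t <= h^-1 * (y (h + t) - y t).
      by rewrite ler_pdivlMl// /g; lra.
    have q2 : h^-1 * (y (h + t) - y t) <= g (h + t).
      by rewrite ler_pdivrMl// /g; lra.
    by rewrite !ler0_norm; lra.
  have hn' : h < 0 by lra.
  have /andP[h1 h2] := Hphi_inv_diff (h + t) t ltac:(lra) ltac:(lra).
  have q1 : g (h + t) <= h^-1 * (y (h + t) - y t).
    by rewrite ler_ndivlMl// /g; lra.
  have q2 : h^-1 * (y (h + t) - y t) <= g t.
    by rewrite ler_ndivrMl// /g; lra.
  by rewrite !ger0_norm; lra.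
near=> h; split; first by near: h; exact: nbhs_dnbhs_neq.
have : `|h| < t by near: h; exact: dnbhs0_lt.
by move=> /ltr_normlP[]; lra.
Unshelve. all: end_near. Qed.

(** * Concavity of the flow *)

Let is_derive_g (t : R) : 0 < t -> is_derive t 1 g (derive1 phi (y t) * g t).
Proof.
move=> t0; apply: is_derive1_comp; last exact: is_derive_Hphi_inv.
apply: DeriveDef; last by rewrite derive1E.
by apply: phi_diff.1; rewrite in_itv/= andbT Hphi_inv_gt1.
Qed.

Let is_derive_shift (f : R -> R) (a t df : R) :
  is_derive (t + a) 1 f df -> is_derive t 1 (fun u : R => f (u + a)) df.
Proof.
move=> fd; rewrite -[df]mulr1.
apply: (@is_derive1_comp R f (fun u : R => u + a)) => //.
by rewrite -[X in is_derive _ _ _ X]addr0; apply: is_deriveD.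
Qed.

Let continuous_shift (f : R -> R) (a : R) : 0 <= a ->
  continuous (fun t : R => f (Num.max 0 t)) ->
  continuous (fun t : R => f (Num.max 0 t + a)).
Proof.
move=> a0 cf.
rewrite (_ : (fun t : R => f (Num.max 0 t + a)) =
   (fun t : R => f (Num.max 0 t)) \o (fun t : R => Num.max 0 t + a)).
  move=> t; apply: continuous_comp; last exact: cf.
  apply: cvgD; last exact: cvg_cst.
  by apply: continuous_max; [exact: cvg_cst|exact: cvg_id].
by apply/funext => t /=; rewrite [Num.max 0 (_ + _)]max_r// addr_ge0.
Qed.

(** The logarithmic derivative of phi(y(t)) is phi'(y(t)), which decreases
    since y increases and phi is concave. *)
Lemma phi_inv_log_concave s t a : 0 <= s -> s <= t -> 0 <= a ->
  phi (y (t + a)) * phi (y s) <= phi (y (s + a)) * phi (y t).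
Proof.
move=> s0 st a0; have t0 := le_trans s0 st.
rewrite -/(g _) -/(g s) -/(g (s + a)) -/(g t).
have gp u : 0 <= u -> g u \is Num.pos by move=> u0; rewrite posrE g_gt0.
rewrite -ler_ln ?posrE ?mulr_gt0 ?g_gt0 ?addr_ge0//.
rewrite !lnM ?gp ?addr_ge0//.
suff : ln (g s) - ln (g (s + a)) <= ln (g t) - ln (g (t + a)) by lra.
have cln : continuous (fun t : R => ln (g (Num.max 0 t))).
  move=> u; apply: continuous_comp; first exact: gg_continuous.
  by apply: continuous_ln; apply: g_gt0.
apply: (@derive_ge0_le _ (fun u : R => ln (g u) - ln (g (u + a)))
  (fun u : R => derive1 phi (y u) - derive1 phi (y (u + a)))) => //.
- move=> u; apply: cvgB; first exact: cln.
  exact: (@continuous_shift (fun u : R => ln (g u))).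
- have dln (v : R) : 0 < v -> is_derive v 1 (fun u : R => ln (g u)) (derive1 phi (y v)).
    move=> v0; have g0 := g_gt0 _ (ltW v0).
    rewrite (_ : derive1 phi (y v) = (g v)^-1 * (derive1 phi (y v) * g v)).
      apply: (@is_derive1_comp R (@ln R) g); last exact: is_derive_g.
      exact: is_derive1_ln.
    by rewrite mulrC mulfK// gt_eqF.
  move=> u su ut; apply: is_deriveB; first by apply: dln; lra.
  by apply: (@is_derive_shift (fun u : R => ln (g u))); apply: dln; lra.
- move=> u su ut; rewrite subr_ge0 phi'_le//.
    by apply: Hphi_inv_gt1; lra.
  by apply: Hphi_inv_le; lra.
Qed.

(** Concavity of the time-[a] map of the flow y(s) |-> y(s + a), as a
    tangent inequality at y(s): its slope phi(y(s + a)) / phi(y(s)) decreases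
    in s by log-concavity. *)
Lemma Hphi_inv_shift_concave s t a : 0 <= s -> 0 <= t -> 0 <= a ->
  phi (y s) * (y (t + a) - y (s + a)) <= phi (y (s + a)) * (y t - y s).
Proof.
move=> s0 t0 a0.
have cD (u v : R) : continuous (fun t : R => u * y (Num.max 0 t) - v * y (Num.max 0 t + a)).
  move=> x; apply: cvgB; apply: cvgM; try exact: cvg_cst.
    exact: yy_continuous.
  exact: (@continuous_shift y).
have dD (u v w : R) : 0 < w -> is_derive w 1 (fun t : R => u * y t - v * y (t + a))
    (u * g w - v * g (w + a)).
  move=> w0; apply: is_deriveB; apply: is_deriveZ.
    exact: is_derive_Hphi_inv.
  by apply: (@is_derive_shift y); apply: is_derive_Hphi_inv; lra.
have [st|ts] := leP s t.
  suff : g (s + a) * y s - g s * y (s + a) <= g (s + a) * y t - g s * y (t + a).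
    by rewrite /g; lra.
  apply: (@derive_ge0_le _ (fun u : R => g (s + a) * y u - g s * y (u + a)) 
    (fun w => g (s + a) * g w - g s * g (w + a)) _ _ s0 st); first exact: cD.
  - by move=> u su _; apply: dD; lra.
  move=> u su _; have := phi_inv_log_concave _ _ _ s0 (ltW su) a0.
  by rewrite /g; lra.
suff : - g (s + a) * y t - - g s * y (t + a) <= - g (s + a) * y s - - g s * y (s + a).
  by rewrite /g; lra.
apply: (@derive_ge0_le _ (fun u : R => - g (s + a) * y u - - g s * y (u + a))
    (fun w => - g (s + a) * g w - - g s * g (w + a)) _ _ t0 (ltW ts)).
- exact: cD.
- by move=> u tu _; apply: dD; lra.
- move=> u tu us; have := phi_inv_log_concave u s a ltac:(lra) (ltW us) a0.
  by rewrite /g; lra.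
Qed.

(** * The rate sequence *)

Section rate_sequence.
Variable eb : R.
Hypotheses (eb_gt0 : 0 < eb) (eb_lt1 : eb < 1).

Let phi1_pos : 0 < phi 1. Proof. exact: phi_gt0. Qed.
Let ebn_ge0 (n : nat) : 0 <= eb * n%:R. Proof. by rewrite mulr_ge0// ltW. Qed.
Let ebnS (n : nat) : eb * n.+1%:R = eb * n%:R + eb.
Proof. by rewrite -[n.+1%:R]natr1 mulrDr mulr1. Qed.
Let ebn_le (m n : nat) : (m <= n)%N -> eb * m%:R <= eb * n%:R.
Proof. by move=> mn; rewrite ler_pM2l// ler_nat. Qed.

Notation r := (rate phi eb).

Lemma rateE n : phi (y (eb * n%:R)) = r n * phi 1.
Proof. by rewrite /rate divfK// gt_eqF. Qed.

Lemma rate0 : r 0 = 1.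
Proof. by rewrite /rate mulr0 Hphi_inv0 divff// gt_eqF. Qed.

Lemma rate_le m n : (m <= n)%N -> r m <= r n.
Proof. by move=> mn; rewrite ler_pM2r ?invr_gt0// g_le// ebn_le. Qed.

Lemma rate_ge1 n : 1 <= r n.
Proof. by rewrite -rate0 rate_le. Qed.

Lemma rate_log_concave k : r k.+2 * r k <= r k.+1 * r k.+1.
Proof.
have := phi_inv_log_concave _ _ eb (ebn_ge0 k) (ebn_le _ _ (leqnSn k)) (ltW eb_gt0).
rewrite -!ebnS !rateE => h.
by rewrite -(ler_pM2r phi1_pos) -(ler_pM2r phi1_pos); lra.
Qed.

Lemma rateS_le k : r k.+1 <= r 1 * r k.
Proof.
have := phi_inv_log_concave _ _ eb (lexx 0) (ebn_ge0 k) (ltW eb_gt0).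
rewrite -!ebnS add0r; have := rateE 1; rewrite mulr1 => ->.
rewrite !rateE Hphi_inv0 => h.
by rewrite -(ler_pM2r phi1_pos) -(ler_pM2r phi1_pos); lra.
Qed.

Let ebn_gt0 n : (0 < n)%N -> 0 < eb * n%:R.
Proof. by move=> n0; rewrite mulr_gt0// ltr0n. Qed.

Lemma delta_ge0 k : (0 < k)%N -> 0 <= delta phi eb k.
Proof. by move=> k0; rewrite mulr_ge0 ?phi'_ge0 ?Hphi_inv_gt1 ?ebn_gt0// ltW. Qed.

Lemma delta_le j k : (0 < j)%N -> (j <= k)%N -> delta phi eb k <= delta phi eb j.
Proof.
move=> j0 jk; rewrite ler_pM2l// phi'_le// ?Hphi_inv_gt1 ?ebn_gt0//.
by rewrite Hphi_inv_le// ebn_le.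
Qed.

(** Tangent inequality for phi at y(eb k). The case [k = 0] is excluded
    because y(0) = 1, where phi is only differentiable on the right. *)
Lemma rate_incr_le k : (0 < k)%N -> r k.+1 - r k <= delta phi eb k * r k.+1.
Proof.
move=> k0; rewrite -(ler_pM2r phi1_pos) mulrBl -[X in _ <= X]mulrA -!rateE.
have kS := ebn_le _ _ (leqnSn k).
have y1 := Hphi_inv_gt1 _ (ebn_gt0 _ k0).
have := phi_tangent _ (y (eb * k.+1%:R)) y1 (Hphi_inv_ge1 _ (ebn_ge0 _)).
have /andP[_] := Hphi_inv_diff _ _ (ebn_ge0 k) kS.
have -> : eb * k.+1%:R - eb * k%:R = eb by rewrite ebnS; lra.
move=> /(ler_wpM2l (phi'_ge0 _ y1)) h1 h2; rewrite /delta; lra.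
Qed.

(** y(eb k) tends to infinity, at least linearly in [k]. *)
Lemma delta_small : derive1 phi t @[t --> +oo] --> 0 ->
  forall e, 0 < e -> exists K, forall k, (K <= k)%N -> delta phi eb k <= e.
Proof.
move=> /cvgrPdist_le cphi e e0.
have /cphi : 0 < e / eb by rewrite divr_gt0.
move=> [A [_ hA]].
pose K := Num.bound (`|A| / (eb * phi 1)).
have ab0 : 0 < eb * phi 1 by rewrite mulr_gt0.
have hK : `|A| <= K%:R * (eb * phi 1).
  rewrite -ler_pdivrMr// ltW//; apply: archi_boundP.
  by rewrite divr_ge0// ltW.
exists K => k Kk; rewrite /delta mulrC -ler_pdivlMr//.
have hy : A < y (eb * k%:R).
  have /andP[h _] := Hphi_inv_diff _ _ (lexx 0) (ebn_ge0 k).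
  rewrite Hphi_inv0 subr0 in h.
  have : K%:R * (eb * phi 1) <= k%:R * (eb * phi 1) by rewrite ler_pM2r// ler_nat.
  have := ler_norm A; lra.
by have := hA _ hy; rewrite sub0r normrN; apply: le_trans; rewrite ler_norm.
Qed.

(** * The shifted flows *)

(** [shifted_flow k] is the k-th term of the usual sequence of Lyapunov
    functions for subgeometric drift conditions, and [flow_slope k] is its
    derivative. *)
Definition shifted_flow k v := y (H v + eb * k%:R) - y (eb * k%:R).
Definition flow_slope k v := phi (y (H v + eb * k%:R)) / phi v.

Notation h := shifted_flow.
Notation s := flow_slope.

Lemma flow_slopeE k v : 1 <= v -> s k v * phi v = phi (y (H v + eb * k%:R)).
Proof. by move=> v1; rewrite divfK// gt_eqF// phi_gt0. Qed.

Lemma shifted_flow0 v : 1 <= v -> h 0 v = v - 1.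
Proof. by move=> v1; rewrite /h mulr0 addr0 HphiK// Hphi_inv0. Qed.

Lemma shifted_flow_ge0 k v : 1 <= v -> 0 <= h k v.
Proof.
move=> v1; rewrite subr_ge0 Hphi_inv_le// lerDr; exact: Hphi_ge0.
Qed.

Lemma shifted_flow1 k : h k 1 = 0.
Proof. by rewrite /h Hphi1 add0r subrr. Qed.

Lemma flow_slope1 k : s k 1 = r k.
Proof. by rewrite /s Hphi1 add0r. Qed.

Lemma flow_slope_ge0 k v : 1 <= v -> 0 <= s k v.
Proof.
move=> v1; rewrite divr_ge0// ltW ?phi_gt0// Hphi_inv_ge1//.
by rewrite addr_ge0// Hphi_ge0.
Qed.

(** The slope is largest at [v = 1], where it equals r(k). *)
Lemma flow_slope_le k v : 1 <= v -> s k v <= r k.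
Proof.
move=> v1; rewrite /s ler_pdivrMr ?phi_gt0//.
have := phi_inv_log_concave 0 (H v) (eb * k%:R) (lexx 0) (Hphi_ge0 _ v1) (ebn_ge0 k).
rewrite add0r HphiK// Hphi_inv0 rateE => h1.
by rewrite -(ler_pM2r phi1_pos); lra.
Qed.

Lemma shifted_flow_tangent k v w : 1 <= v -> 1 <= w ->
  h k w <= h k v + s k v * (w - v).
Proof.
move=> v1 w1.
have := Hphi_inv_shift_concave _ _ _ (Hphi_ge0 _ v1) (Hphi_ge0 _ w1) (ebn_ge0 k).
rewrite !HphiK// => h1; rewrite -(ler_pM2l (phi_gt0 _ v1)).
suff : phi v * h k w <= phi v * h k v + s k v * phi v * (w - v) by lra.
by rewrite flow_slopeE// /h; lra.
Qed.

(** Over one step of length eb, y advances at most at its final speed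
    from H(v) + eb k, and at least at its initial speed from eb k. *)
Lemma shifted_flow_drift k v : 1 <= v ->
  h k.+1 v - s k.+1 v * (eb * phi v) <= h k v - eb * phi 1 * r k.
Proof.
move=> v1; rewrite mulrCA flow_slopeE// /h.
have Hv := Hphi_ge0 _ v1.
have /andP[_ h1] := Hphi_inv_diff (H v + eb * k%:R) (H v + eb * k.+1%:R)
  (addr_ge0 Hv (ebn_ge0 k)) ltac:(by rewrite lerD2l ebn_le).
have /andP[h2 _] := Hphi_inv_diff _ _ (ebn_ge0 k) (ebn_le _ _ (leqnSn k)).
move: h1 h2; rewrite rateE.
have -> : H v + eb * k.+1%:R - (H v + eb * k%:R) = eb by rewrite ebnS; lra.
have -> : eb * k.+1%:R - eb * k%:R = eb by rewrite ebnS; lra.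
lra.
Qed.

(** The relative increment of r plays the role of [delta], with the advantage
    of being meaningful at [k = 0]. *)
Definition rate_growth k := r k.+1 / r k - 1.
Notation rg := rate_growth.

Let r_gt0 k : 0 < r k. Proof. by rewrite (lt_le_trans ltr01)// rate_ge1. Qed.

Lemma rate_growthE k : rg k * r k = r k.+1 - r k.
Proof. by rewrite mulrBl mul1r divfK// gt_eqF. Qed.

Lemma rate_growth_ge0 k : 0 <= rg k.
Proof. by rewrite subr_ge0 ler_pdivlMr// mul1r rate_le. Qed.

Lemma rate_growth_le k : rg k.+1 <= rg k.
Proof.
by rewrite lerD2r ler_pdivrMr// mulrAC ler_pdivlMr// rate_log_concave.
Qed.

Lemma rate_growth_delta k : (0 < k)%N -> rg k <= delta phi eb k * r 1.
Proof.
move=> k0; rewrite -(ler_pM2r (r_gt0 k)) rate_growthE.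
apply: le_trans (rate_incr_le _ k0) _; rewrite -[X in _ <= X]mulrA.
by rewrite ler_wpM2l ?delta_ge0// rateS_le.
Qed.

(** * Weighted number of visits of C x C *)

Section potential.
Variables bV cV enu : R.
Hypotheses (enu_gt0 : 0 < enu) (enu_lt1 : enu < 1).
Hypothesis bV_ge0 : 0 <= bV.
Hypothesis cV_ge1 : 1 <= cV.

Ltac slra := move: enu_gt0 enu_lt1 bV_ge0 cV_ge1 => ? ? ? ?; lra.

Notation bb := (bbar phi bV eb).
Notation M := (M1 phi bV cV eb enu).
Notation dl := (delta phi eb).

Notation al := (eb * phi 1).
Notation kp := (r 1 / al).
Notation mm := (2 * ((bV + cV) / (1 - enu) - 1)).

Let al_gt0 : 0 < al. Proof. exact: mulr_gt0. Qed.
Let kp_ge0 : 0 <= kp. Proof. by rewrite divr_ge0 ?ltW. Qed.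
Let bbE : bb = 2 * bV + al. Proof. by []. Qed.
Let bb_ge0 : 0 <= bb. Proof. by rewrite bbE; apply: addr_ge0; [exact: mulr_ge0|exact: ltW]. Qed.

Let mm_ge0 : 0 <= mm.
Proof.
have e0 : 0 < 1 - enu by rewrite subr_gt0.
by rewrite mulr_ge0// subr_ge0 ler_pdivlMr// mul1r; slra.
Qed.

Let ME : M = r 1 * (1 + kp * mm).
Proof. by rewrite /M; field; rewrite !gt_eqF//= ?subr_gt0. Qed.

Let M_ge0 : 0 <= M.
Proof.
rewrite ME; apply: mulr_ge0; first exact: ltW.
by apply: addr_ge0 => //; exact: mulr_ge0.
Qed.

Let step_ge0 k : (0 < k)%N -> 0 <= (1 - enu) * (1 + dl k * M).
Proof.
move=> k0; apply: mulr_ge0; first slra.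
by apply: addr_ge0 => //; apply: mulr_ge0 => //; exact: delta_ge0.
Qed.

(** For a pair of chains in C x C at time [k], [visits k m] bounds the
    expected sum, relative to r(k+1), of r(n+1) over the visits of C x C at
    the [m] times from [k] on: the chains survive with probability [1 - enu], and
    r then grows on average by at most [1 + delta (k+1) M1] until the next
    visit. *)
Fixpoint visits k m := if m is m'.+1
  then 1 + (1 - enu) * (1 + dl k.+1 * M) * visits k.+1 m' else 0.

Lemma visits_ge0 k m : 0 <= visits k m.
Proof.
elim: m k => //= m IH k; apply: addr_ge0 => //.
by apply: mulr_ge0 => //; exact: step_ge0.
Qed.

Lemma visits_leS k m : visits k m <= visits k m.+1.
Proof.
elim: m k => [k|m IH k]; first exact: visits_ge0.
rewrite [visits k m.+1]/= [visits k m.+2]/= lerD2l.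
by apply: ler_wpM2l => //; exact: step_ge0.
Qed.

Lemma visits_shift k m : visits k.+1 m <= visits k m.
Proof.
elim: m k => //= m IH k; rewrite lerD2l; apply: ler_pM => //.
- exact: step_ge0.
- exact: visits_ge0.
- apply: ler_wpM2l; first slra.
  by rewrite lerD2l; apply: ler_wpM2r => //; exact: delta_le.
Qed.

Lemma visitsE k m : visits k m =
  \sum_(0 <= j < m) (1 - enu) ^+ j * \prod_(1 <= i < j.+1) (1 + dl (k + i) * M).
Proof.
elim: m k => [k|m IH k]; first by rewrite big_nil.
rewrite big_nat_recl// expr0 mul1r big_nil /= IH; congr (_ + _).
rewrite big_distrr/=; apply: eq_bigr => j _.
rewrite exprS [in RHS]big_nat_recl// addn1.
under eq_bigr do rewrite addSnnS.
by rewrite !mulrA; congr (_ * _); rewrite mulrAC.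
Qed.

(** Since [delta] tends to 0, the factor of the recursion is eventually at
    most [1 - enu / 2], whose geometric series sums to [2 / enu]; finitely many
    backward steps then lead to [k = 0]. *)
Lemma visits_bounded : derive1 phi t @[t --> +oo] --> 0 ->
  exists B, forall m, visits 0 m <= B.
Proof.
move=> phi'0; have [M0 e0 e1] := And3 M_ge0 enu_gt0 enu_lt1.
have M1p : 0 < M + 1 by lra.
have e20 : 0 < enu / 2 / (M + 1) by rewrite !divr_gt0.
have [K hK] := delta_small phi'0 _ e20.
have hbig m k : (K <= k)%N -> visits k m <= 2 / enu.
  elim: m k => [k _|m IH k Kk] /=; first by rewrite divr_ge0// ltW.
  have dM : dl k.+1 * M <= enu / 2.
    have h1 : dl k.+1 * (M + 1) <= enu / 2 by rewrite -ler_pdivlMr ?hK ?leqW.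
    apply: le_trans h1; apply: ler_wpM2l; [exact: delta_ge0|lra].
  have q : (1 - enu) * (1 + dl k.+1 * M) <= 1 - enu / 2.
    apply: (@le_trans _ _ ((1 - enu) * (1 + enu / 2))).
      by apply: ler_wpM2l; lra.
    nra.
  apply: (@le_trans _ _ (1 + (1 - enu / 2) * (2 / enu))).
    rewrite lerD2l; apply: ler_pM => //; [exact: step_ge0|exact: visits_ge0|].
    exact: IH _ (leqW Kk).
  by rewrite le_eqVlt; apply/orP; left; apply/eqP; field; lra.
suff main n : (n <= K)%N -> exists B, forall m, visits (K - n) m <= B.
  by have := main K (leqnn K); rewrite subnn.
elim: n => [_|n IH nK].
  by exists (2 / enu) => m; apply: hbig; rewrite subn0.
have [B hB] := IH (ltnW nK).
have Kn : (0 < K - n)%N by rewrite subn_gt0.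
exists (1 + (1 - enu) * (1 + dl (K - n) * M) * `|B|) => -[|m].
  apply: addr_ge0 => //; apply: mulr_ge0 => //; exact: step_ge0.
rewrite /= subnSK// lerD2l; apply: ler_wpM2l; first exact: step_ge0.
by rewrite (le_trans (hB m))// ler_norm.
Qed.

(** * The potential *)

(** See the introduction for the role of each term. The whole sum is divided
    by [eb * phi 1] because that is the factor with which the drift pays for
    the cost of a stage. *)
Definition potential k c v :=
  (2 * h k v + 2 * bb * c * (r k.+1 + rg k * kp * h k v) + v + bb / enu) / al.

Lemma potential_ge0 k c v : 0 <= c -> 1 <= v -> 0 <= potential k c v.
Proof.
move=> c0 v1; have h0 := shifted_flow_ge0 k _ v1; apply: divr_ge0; last exact: ltW.
apply: addr_ge0; last by apply: divr_ge0 => //; exact: ltW.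
apply: addr_ge0; last lra.
apply: addr_ge0; first lra.
apply: mulr_ge0; first by apply: mulr_ge0 => //; apply: mulr_ge0.
apply: addr_ge0; first exact: ltW.
by apply: mulr_ge0 => //; apply: mulr_ge0 => //; exact: rate_growth_ge0.
Qed.

Notation stage k V V' := (2 * r k + (phi V + phi V') / phi 1).

Let stageE k V V' p q Z : stage k V V' + (p / al + q / al * Z) =
  (2 * (al * r k) + eb * (phi V + phi V') + p + q * Z) / al.
Proof. by field; rewrite !gt_eqF. Qed.

(** Outside C x C no mass is lost and [Z] is the mean of V + V' - 1 after one
    step. The affine majorant replaces h_(k+1) by its tangent at the current
    point [v0], whose mean is at most h_k(v0) - eb phi(1) r(k). *)
Lemma potential_step_out k c c' V V' Z : 0 <= c -> c <= c' ->
  1 <= V -> 1 <= V' -> Z <= V + V' - 1 - eb * (phi V + phi V') ->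
  exists p q, [/\ 0 <= q, forall v, 1 <= v -> potential k.+1 c v <= p + q * v &
    stage k V V' + (p + q * Z) <= potential k c' (V + V' - 1)].
Proof.
move=> c0 cc' V1 V1' hZ; set v0 := V + V' - 1.
have v1 : 1 <= v0 by rewrite /v0; lra.
have s0 := flow_slope_ge0 k.+1 _ v1.
have hk0 := shifted_flow_ge0 k _ v1.
have g0 := rate_growth_ge0 k.+1.
have g01 := rate_growth_le k.
have Phi_ge : phi v0 <= phi V + phi V'.
  by have := phi_subadd _ _ V1 V1'; have := phi1_pos; rewrite -/v0; lra.
have drift : h k.+1 v0 - s k.+1 v0 * (eb * (phi V + phi V')) <= h k v0 - al * r k.
  apply: le_trans (shifted_flow_drift k _ v1); rewrite lerD2l lerN2.
  by apply: ler_wpM2l => //; apply: ler_wpM2l => //; exact: ltW.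
pose D := 2 * bb * c.
have D0 : 0 <= D by apply: mulr_ge0 => //; apply: mulr_ge0.
have D' : D <= 2 * bb * c' by apply: ler_wpM2l => //; apply: mulr_ge0.
pose B := 2 + D * rg k.+1 * kp.
have B0 : 0 <= B.
  by apply: addr_ge0 => //; apply: mulr_ge0 => //; apply: mulr_ge0.
pose A := D * r k.+2 + bb / enu.
exists ((A + B * (h k.+1 v0 - s k.+1 v0 * v0)) / al), ((B * s k.+1 v0 + 1) / al).
split.
- apply: divr_ge0; last exact: ltW.
  by apply: addr_ge0 => //; apply: mulr_ge0.
- move=> v v1'; rewrite [X in _ <= _ + X]mulrAC -[X in _ <= X]mulrDl ler_pM2r ?invr_gt0//.
  have := ler_wpM2l B0 (shifted_flow_tangent k.+1 _ _ v1 v1').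
  by rewrite /A /B -/D; lra.
- rewrite stageE /potential ler_pM2r ?invr_gt0//.
  have q0 : 0 <= B * s k.+1 v0 + 1 by apply: addr_ge0 => //; apply: mulr_ge0.
  have h1 := ler_wpM2l q0 hZ; rewrite -/v0 in h1.
  have h2 := ler_wpM2l B0 drift.
  have inner : r k.+2 + rg k.+1 * kp * (h k v0 - al * r k) <=
      r k.+1 + rg k * kp * h k v0.
    have e1 : rg k.+1 * kp * (al * r k) = rg k.+1 * (r 1 * r k).
      by field; rewrite !gt_eqF.
    have e2 := rate_growthE k.+1.
    have h3 := ler_wpM2l g0 (rateS_le k).
    have h4 : rg k.+1 * (kp * h k v0) <= rg k * (kp * h k v0).
      by apply: ler_wpM2r => //; apply: mulr_ge0.
    lra.
  have h5 : 0 <= r k.+1 + rg k * kp * h k v0.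
    apply: addr_ge0; first exact: ltW.
    by apply: mulr_ge0 => //; apply: mulr_ge0 => //; exact: rate_growth_ge0.
  have h6 := ler_wpM2l D0 inner.
  have h7 := ler_wpM2r h5 D'.
  have e3 : B * (h k v0 - al * r k) =
    2 * (h k v0 - al * r k) + D * (rg k.+1 * kp * (h k v0 - al * r k)).
    by rewrite /B; ring.
  move: h1 h2 h6 h7; rewrite e3 /A => h1 h2 h6 h7.
  lra.
Qed.

(** In C x C the mass is multiplied by [1 - enu] and [Z] is the mean of
    V + V' - 1 over what is left. The two occurrences of h_(k+1) receive
    different tangents: at the current point in the first term, which gives a
    rise of 2 bV r(k+1); at 1 in the second one, where the bound on [Z]
    makes the constant [M1] appear. *)
Lemma potential_step_in k c V V' Z : 0 <= c -> 1 <= V -> 1 <= V' ->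
  Z <= V + V' - 1 - (phi V + phi V') + 2 * bV - enu ->
  Z <= (1 - enu) * (1 + mm) ->
  exists p q, [/\ 0 <= q, forall v, 1 <= v -> potential k.+1 c v <= p + q * v &
    stage k V V' + ((1 - enu) * p + q * Z) <=
    potential k (1 + (1 - enu) * (1 + dl k.+1 * M) * c) (V + V' - 1)].
Proof.
move=> c0 V1 V1' hZ hZ'; set v0 := V + V' - 1.
have v1 : 1 <= v0 by rewrite /v0; lra.
have one1 : 1 <= 1 :> R by [].
have s0 := flow_slope_ge0 k.+1 _ v1.
have hk0 := shifted_flow_ge0 k _ v1.
have g0 := rate_growth_ge0 k.+1.
have g00 := rate_growth_ge0 k.
have e0 : 0 < 1 - enu by rewrite subr_gt0.
have Phi_ge : phi v0 <= phi V + phi V'.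
  by have := phi_subadd _ _ V1 V1'; have := phi1_pos; rewrite -/v0; lra.
have Phi_eb : eb * phi v0 <= phi V + phi V'.
  by apply: le_trans Phi_ge; apply: ler_piMl; apply: ltW => //; exact: phi_gt0.
have Phi_eb' : eb * (phi V + phi V') <= phi V + phi V'.
  by apply: ler_piMl; [apply: addr_ge0|]; apply: ltW => //; exact: phi_gt0.
pose D := 2 * bb * c.
have D0 : 0 <= D by apply: mulr_ge0 => //; apply: mulr_ge0.
pose B := D * rg k.+1 * kp.
have B0 : 0 <= B by apply: mulr_ge0 => //; apply: mulr_ge0.
pose A := D * r k.+2 + bb / enu.
exists ((A + 2 * (h k.+1 v0 - s k.+1 v0 * v0) - B * r k.+1) / al).
exists ((2 * s k.+1 v0 + B * r k.+1 + 1) / al).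
split.
- apply: divr_ge0; last exact: ltW.
  apply: addr_ge0 => //; apply: addr_ge0; first exact: mulr_ge0.
  by apply: mulr_ge0 => //; exact: ltW.
- move=> v v1'; rewrite [X in _ <= _ + X]mulrAC -[X in _ <= X]mulrDl ler_pM2r ?invr_gt0//.
  have h1 := shifted_flow_tangent k.+1 _ _ v1 v1'.
  have := ler_wpM2l B0 (shifted_flow_tangent k.+1 _ _ one1 v1').
  by rewrite shifted_flow1 flow_slope1 /A /B -/D; lra.
- rewrite [X in _ + (X + _)]mulrA stageE /potential ler_pM2r ?invr_gt0//.
  (* Losing the mass enu costs nothing: at 1, the tangent of h_(k+1) at v0 is
     at least h_(k+1)(1) = 0. *)
  have drift : (1 - enu) * (h k.+1 v0 - s k.+1 v0 * v0) + s k.+1 v0 * Z <=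
      h k v0 - al * r k + 2 * bV * r k.+1.
    have h1 := ler_wpM2l s0 hZ; rewrite -/v0 in h1.
    have h2 : 0 <= enu * (h k.+1 v0 + s k.+1 v0 * (1 - v0)).
      apply: mulr_ge0; first exact: ltW.
      by rewrite -(shifted_flow1 k.+1); exact: shifted_flow_tangent.
    have h3 := ler_wpM2l s0 Phi_eb.
    have h4 := shifted_flow_drift k _ v1.
    have h5 : 2 * bV * s k.+1 v0 <= 2 * bV * r k.+1.
      by apply: ler_wpM2l; [exact: mulr_ge0|exact: flow_slope_le].
    lra.
  have inner : (1 - enu) * r k.+2 + rg k.+1 * kp * r k.+1 * (Z - (1 - enu)) <=
      (1 - enu) * (1 + dl k.+1 * M) * r k.+1.
    have h1 : rg k.+1 * kp * r k.+1 * (Z - (1 - enu)) <=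
        rg k.+1 * kp * r k.+1 * ((1 - enu) * mm).
      apply: ler_wpM2l; last lra.
      by apply: mulr_ge0; [apply: mulr_ge0|exact: ltW].
    have h2 : (1 - enu) * r k.+1 * (1 + kp * mm) * rg k.+1 <=
        (1 - enu) * r k.+1 * (1 + kp * mm) * (dl k.+1 * r 1).
      apply: ler_wpM2l; last exact: rate_growth_delta.
      apply: mulr_ge0; first by apply: mulr_ge0; exact: ltW.
      by apply: addr_ge0 => //; apply: mulr_ge0.
    have e2 := rate_growthE k.+1.
    have e3 : (1 - enu) * r k.+2 = (1 - enu) * (rg k.+1 * r k.+1 + r k.+1).
      by rewrite e2 subrK.
    move: h1 h2; rewrite ME e3; set m := mm; set K := kp => h1 h2.
    lra.
  have h6 := ler_wpM2l D0 inner.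
  have h7 : 0 <= 2 * bb * (1 + (1 - enu) * (1 + dl k.+1 * M) * c) *
     (rg k * kp * h k v0).
    apply: mulr_ge0; last by apply: mulr_ge0 => //; apply: mulr_ge0.
    apply: mulr_ge0; first exact: mulr_ge0.
    by apply: addr_ge0 => //; apply: mulr_ge0 => //; exact: step_ge0.
  have h8 : (1 - enu) * (bb / enu) = bb / enu - bb by field; rewrite gt_eqF.
  have h9 : 2 * bV <= bb by rewrite bbE lerDl ltW.
  have h10 : 2 * bV * r k.+1 <= bb * r k.+1 by apply: ler_wpM2r => //; exact: ltW.
  have h11 := enu_gt0.
  have e4 : 2 * bb * (1 + (1 - enu) * (1 + dl k.+1 * M) * c) * r k.+1 =
    2 * bb * r k.+1 + D * ((1 - enu) * (1 + dl k.+1 * M) * r k.+1).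
    by rewrite /D; ring.
  rewrite [X in _ <= _ + X + _ + _]mulrDr e4.
  have e5 : (1 - enu) * (A + 2 * (h k.+1 v0 - s k.+1 v0 * v0) - B * r k.+1) +
     (2 * s k.+1 v0 + B * r k.+1 + 1) * Z =
     2 * ((1 - enu) * (h k.+1 v0 - s k.+1 v0 * v0) + s k.+1 v0 * Z) +
     D * ((1 - enu) * r k.+2 + rg k.+1 * kp * r k.+1 * (Z - (1 - enu))) +
     (1 - enu) * (bb / enu) + Z.
    by rewrite /A /B; ring.
  rewrite -addrA e5 h8.
  rewrite -/v0 in hZ.
  move: drift h6 h7 h9 h10 h11 Phi_eb' hZ.
  set X1 := D * _; set X2 := D * _; set X3 := 2 * bb * _ * _.
  set X4 := (1 - enu) * _ + _ * Z; set X5 := bb / enu.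
  clearbody X1 X2 X3 X4 X5 v0 => *.
  lra.
Qed.

Lemma potential0_le c v : 0 <= c -> 1 <= v ->
  potential 0 c v <=
  2 / al * (2 + bb / enu + c * (bb * r 1 * (1 + r 1 / al))) * v.
Proof.
move=> c0 v1; rewrite /potential shifted_flow0//.
rewrite /rate_growth rate0 divr1.
have -> : 2 / al * (2 + bb / enu + c * (bb * r 1 * (1 + kp))) * v =
  (2 * (2 + bb / enu + c * (bb * r 1 * (1 + kp))) * v) / al by ring.
rewrite ler_pM2r ?invr_gt0//.
have be0 : 0 <= bb / enu by apply: divr_ge0 => //; exact: ltW.
have h1 : bb / enu <= bb / enu * v by apply: ler_peMr.
have r11 := rate_ge1 1.
have h2 : 2 * bb * c * (r 1 + (r 1 - 1) * kp * (v - 1)) <=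
    2 * bb * c * (r 1 * (1 + kp) * v).
  apply: ler_wpM2l; first by apply: mulr_ge0 => //; apply: mulr_ge0.
  have h3 : 0 <= kp * (v - 1) by apply: mulr_ge0 => //; lra.
  have h4 : 0 <= r 1 * (v - 1) by apply: mulr_ge0; lra.
  have h5 : 0 <= r 1 * kp by apply: mulr_ge0 => //; lra.
  lra.
lra.
Qed.

(** * Oscillation of the backward sums *)

Section chain_bound.
Context {d} {T : measurableType d}.
Variables (P : nat -> R.-pker T ~> T) (C : set T) (V : T -> R).
Variable nu : nat -> probability T R.
Hypothesis mV : measurable_fun [set: T] V.
Hypothesis V_ge1 : forall x, 1 <= V x.
Hypothesis drift : forall k x, (1 <= k)%N ->
  (\int[P k x]_y (V y)%:E <= (V x - phi (V x) + bV * \1_C x)%:E)%E.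
Hypothesis minor : forall k x A, (1 <= k)%N -> C x -> measurable A ->
  (enu%:E * nu k A <= P k x A)%E.
Hypothesis outC : forall x, ~ C x -> bV <= (1 - eb) * phi (V x).
Hypothesis inC : forall x, C x -> V x <= cV.

Let phiV_gt0 x : 0 < phi (V x). Proof. exact: phi_gt0. Qed.

Let PV_le k x : (1 <= k)%N -> (\int[P k x]_y (V y)%:E <= (V x + bV)%:E)%E.
Proof.
move=> k1; apply: le_trans (drift k x k1) _; rewrite lee_fin.
have := phiV_gt0 x; have b0 := bV_ge0; rewrite indicE; case: (x \in C) => /=; lra.
Qed.

Let dV := dominatedV V mV V_ge1.

Let transition_drift k x : (1 <= k)%N ->
  transition P k V x <= V x - phi (V x) + bV * \1_C x.
Proof.
move=> k1; rewrite -lee_fin.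
by rewrite -(transitionE P V bV mV V_ge1 PV_le k V x k1 dV) drift.
Qed.

Let indicC x : C x -> \1_C x = 1 :> R.
Proof. by move=> Cx; rewrite indicE mem_set. Qed.

Let indicCN x : ~ C x -> \1_C x = 0 :> R.
Proof. by move=> Cx; rewrite indicE memNset. Qed.

Let drift_out k x x' : (1 <= k)%N -> ~ (C x /\ C x') ->
  transition P k V x + transition P k V x' - 1 <=
  V x + V x' - 1 - eb * (phi (V x) + phi (V x')).
Proof.
move=> k1 nC; have d1 := transition_drift k x k1.
have d2 := transition_drift k x' k1; have b0 := bV_ge0.
have e1 (z : T) : eb * phi (V z) <= phi (V z).
  by apply: ler_piMl; apply: ltW => //; exact: phiV_gt0.
have f1 := e1 x; have f2 := e1 x'.
have [Cx|Cx] := pselect (C x); have [Cx'|Cx'] := pselect (C x').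
- by exfalso; apply: nC.
- by rewrite (indicC x Cx) in d1; rewrite (indicCN x' Cx') in d2;
    have o := outC _ Cx'; lra.
- by rewrite (indicCN x Cx) in d1; rewrite (indicC x' Cx') in d2;
    have o := outC _ Cx; lra.
- by rewrite (indicCN x Cx) in d1; rewrite (indicCN x' Cx') in d2; lra.
Qed.

(** Backward induction on the time: the one-step contraction applied to the
    affine majorants of the potential. Outside C x C it is applied with [e = 0]
    and with the kernel itself as minorising measure. *)
Lemma backward_sum_oscillation a f w : dominated V f -> 0 <= w ->
  (forall k y y', a k * (f y - f y') <= w * stage k (V y) (V y')) ->
  forall m k y y', backward_sum P a f k m y - backward_sum P a f k m y' <=
    w * potential k (visits k m) (V y + V y' - 1).
Proof.
move=> df w0 hf; elim=> [|m IH] k x x'.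
  rewrite /= subrr; apply: mulr_ge0 => //; apply: potential_ge0 => //.
  by have := V_ge1 x; have := V_ge1 x'; lra.
rewrite [backward_sum _ _ _ _ m.+1]/=.
set S := backward_sum P a f k.+1 m.
have dS : dominated V S := dominated_backward_sum P V bV mV V_ge1 bV_ge0 PV_le a f k.+1 m df.
have iV z : (P k.+1 z).-integrable [set: T] (EFin \o V).
  exact: (integrable_V P V bV mV V_ge1 PV_le k.+1 z).
have iS z : (P k.+1 z).-integrable [set: T] (EFin \o S).
  by apply: dominated_integrable (iV z) dS.
have c0 := visits_ge0 k.+1 m.
have V1 := V_ge1 x; have V1' := V_ge1 x'.
have VV z z' : 1 <= V z + V z' - 1 by have := V_ge1 z; have := V_ge1 z'; lra.
have hstep := hf k x x'.
have mass z : P k.+1 z [set: T] = 1%E by rewrite prob_kernel.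
have [[Cx Cx']|nC] := pselect (C x /\ C x').
- have nu1 : nu k.+1 [set: T] = 1%E by exact: probability_setT.
  have mn z : C z -> forall A, measurable A -> (enu%:E * nu k.+1 A <= P k.+1 z A)%E.
    by move=> Cz A mA; exact: minor.
  have iVn : (nu k.+1).-integrable [set: T] (EFin \o V).
    apply: (@integrable_V_of_le _ _ _ V mV V_ge1 _ (enu^-1 * (V x + bV))).
    rewrite EFinM lee_pdivlMl//.
    apply: le_trans (PV_le k.+1 x isT).
    apply: ge0_le_integral_minor => //; [exact: ltW|exact: mn| |exact/measurable_EFinP].
    by move=> z; rewrite lee_fin (le_trans _ (V_ge1 z)).
  have iSn := dominated_integrable V V_ge1 _ _ iVn dS.
  set N := \int[nu k.+1]_z V z.
  have N1 : 1 <= N := Rintegral_ge (nu k.+1) V 1 nu1 iVn V_ge1.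
  pose Z := transition P k.+1 V x + transition P k.+1 V x' - 2 * enu * N - (1 - enu).
  have d1 := transition_drift k.+1 x isT; have d2 := transition_drift k.+1 x' isT.
  rewrite indicC// mulr1 in d1; rewrite indicC// mulr1 in d2.
  have eN : enu <= enu * N by apply: ler_peMr => //; exact: ltW.
  have hZ : Z <= V x + V x' - 1 - (phi (V x) + phi (V x')) + 2 * bV - enu.
    by rewrite /Z; lra.
  have hZ' : Z <= (1 - enu) * (1 + mm).
    have e0 := enu_gt0; have e1 := enu_lt1.
    have -> : (1 - enu) * (1 + mm) = 2 * (bV + cV) - (1 - enu) by field; lra.
    have i1 := inC _ Cx; have i2 := inC _ Cx'.
    have f1 := phiV_gt0 x; have f2 := phiV_gt0 x'.
    clear hstep; rewrite /Z; lra.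
  have [p [q [q0 hpq hfin]]] := potential_step_in k _ _ _ _ c0 V1 V1' hZ hZ'.
  have := one_step_contraction (P k.+1 x) (P k.+1 x') (nu k.+1) V S enu (w * p) (w * q)
    (mass x) (mass x') nu1 (ltW enu_gt0) enu_lt1 (mn x Cx) (mn x' Cx') (iV x) (iS x)
    (iV x') (iS x') iVn iSn.
  have hS y y' : S y - S y' <= w * p + w * q * (V y + V y' - 1).
    apply: le_trans (IH _ _ _) _; rewrite -mulrA -mulrDr; apply: ler_wpM2l => //.
    exact: hpq.
  move=> /(_ hS); rewrite -/N -/(transition P k.+1 S x) -/(transition P k.+1 S x').
  rewrite -/(transition P k.+1 V x) -/(transition P k.+1 V x') -/Z => hone.
  have := ler_wpM2l w0 hfin; rewrite [visits k m.+1]/=; lra.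
- have nu0 (z : T) (A : set T) : measurable A -> (0%R%:E * P k.+1 x A <= P k.+1 z A)%E.
    by move=> mA; rewrite mul0e.
  have cc : visits k.+1 m <= visits k m.+1.
    by apply: le_trans (visits_shift _ _) (visits_leS _ _).
  have hZ := drift_out k.+1 x x' isT nC.
  have [p [q [q0 hpq hfin]]] := potential_step_out k _ _ _ _ _ c0 cc V1 V1' hZ.
  have := one_step_contraction (P k.+1 x) (P k.+1 x') (P k.+1 x) V S 0 (w * p) (w * q)
    (mass x) (mass x') (mass x) (lexx 0) ltr01 (nu0 x) (nu0 x') (iV x) (iS x)
    (iV x') (iS x') (iV x) (iS x).
  have hS y y' : S y - S y' <= w * p + w * q * (V y + V y' - 1).
    apply: le_trans (IH _ _ _) _; rewrite -mulrA -mulrDr; apply: ler_wpM2l => //.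
    exact: hpq.
  move=> /(_ hS); rewrite -/(transition P k.+1 S x) -/(transition P k.+1 S x').
  rewrite -/(transition P k.+1 V x) -/(transition P k.+1 V x') => hone.
  have := ler_wpM2l w0 hfin; lra.
Qed.

Lemma weighted_sum_le a f w x x' N : dominated V f -> 0 <= w ->
  (forall k y y', a k * (f y - f y') <= w * stage k (V y) (V y')) ->
  \sum_(0 <= i < N) a i * (\int[kprod P i x]_y f y - \int[kprod P i x']_y f y) <=
    w * potential 0 (visits 0 N) (V x + V x' - 1).
Proof.
move=> df w0 hf.
have k0 z : backward_sum P a f 0 N z =
    \sum_(0 <= i < N) a i * \int[kprod P i z]_y f y.
  have <- := kprod_backward_sum P V bV mV V_ge1 bV_ge0 PV_le a f 0 N z df.
  have [mB _] := dominated_backward_sum P V bV mV V_ge1 bV_ge0 PV_le a f 0 N df.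
  rewrite /Rintegral /= integral_dirac//; last exact/measurable_EFinP.
  by rewrite diracT mul1e.
under eq_bigr do rewrite mulrBr.
by rewrite sumrB -!k0; exact: backward_sum_oscillation.
Qed.

End chain_bound.

(** * Finiteness of the constant, and the bound on the series *)

Notation cs := (cstar phi bV cV eb enu).

Let cterm j := (1 - enu) ^+ j.-1 * \prod_(1 <= k < j) (1 + dl k * M).

Let cterm_ge0 j : 0 <= cterm j.
Proof.
apply: mulr_ge0; first by apply: exprn_ge0; slra.
rewrite big_nat_cond; apply: prodr_ge0 => k /andP[/andP[k1 _] _].
by apply: addr_ge0 => //; apply: mulr_ge0 => //; exact: delta_ge0.
Qed.

Let visits_cterm N : visits 0 N = \sum_(1 <= j < N.+1) cterm j.
Proof. by rewrite visitsE big_add1. Qed.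

Hypothesis phi'_cvg0 : derive1 phi t @[t --> +oo] --> 0.

Lemma cstar_fin_num : cs \is a fin_num.
Proof.
have c0 : (0 <= cs)%E by apply: nneseries_ge0 => j _ _; rewrite lee_fin cterm_ge0.
rewrite ge0_fin_numE//; have [B hB] := visits_bounded phi'_cvg0.
apply: (@le_lt_trans _ _ B%:E); last exact: ltry.
apply: lime_le; first by apply: is_cvg_nneseries => j _ _; rewrite lee_fin cterm_ge0.
near=> N; have N0 : (0 < N)%N by near: N; exact: nbhs_infty_gt.
by rewrite sumEFin lee_fin -(prednK N0) -visits_cterm.
Unshelve. all: end_near. Qed.

Lemma visits_le_cstar N : visits 0 N <= fine cs.
Proof.
rewrite -lee_fin fineK ?cstar_fin_num// visits_cterm -sumEFin.
by apply: nneseries_lim_ge => j _ _; rewrite lee_fin cterm_ge0.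
Qed.

Lemma cstar_ge0 : 0 <= fine cs.
Proof. exact: (visits_le_cstar 0). Qed.

Lemma cboundE : cbound phi bV cV eb enu =
  (2 / al * (2 + bb / enu + fine cs * (bb * r 1 * (1 + r 1 / al))))%:E.
Proof. by rewrite EFinM EFinD (EFinM (fine _)) fineK ?cstar_fin_num. Qed.

Lemma cbound_ge0 : 0 <= fine (cbound phi bV cV eb enu).
Proof.
rewrite cboundE /=; apply: mulr_ge0; first by apply: divr_ge0 => //; exact: ltW.
apply: addr_ge0; first by apply: addr_ge0 => //; apply: divr_ge0 => //; exact: ltW.
apply: mulr_ge0; first exact: cstar_ge0.
by apply: mulr_ge0; [apply: mulr_ge0 => //; exact: ltW|exact: addr_ge0].
Qed.

Lemma potential0_cbound N v : 1 <= v ->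
  potential 0 (visits 0 N) v <= fine (cbound phi bV cV eb enu) * v.
Proof.
move=> v1; apply: le_trans (potential0_le _ _ (visits_ge0 _ _) v1) _.
have v0 : 0 <= v by exact: le_trans v1.
apply: ler_wpM2r => //; rewrite cboundE /=; apply: ler_wpM2l.
  by apply: divr_ge0 => //; exact: ltW.
rewrite lerD2l; apply: ler_wpM2r; last exact: visits_le_cstar.
by apply: mulr_ge0; [apply: mulr_ge0 => //; exact: ltW|exact: addr_ge0].
Qed.

Section weighted_series.
Context {d} {T : measurableType d}.
Variables (P : nat -> R.-pker T ~> T) (C : set T) (V : T -> R).
Variable nu : nat -> probability T R.
Hypothesis mV : measurable_fun [set: T] V.
Hypothesis V_ge1 : forall x, 1 <= V x.
Hypothesis drift : forall k x, (1 <= k)%N ->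
  (\int[P k x]_y (V y)%:E <= (V x - phi (V x) + bV * \1_C x)%:E)%E.
Hypothesis minor : forall k x A, (1 <= k)%N -> C x -> measurable A ->
  (enu%:E * nu k A <= P k x A)%E.
Hypothesis outC : forall x, ~ C x -> bV <= (1 - eb) * phi (V x).
Hypothesis inC : forall x, C x -> V x <= cV.
Variables (Psi1 Psi2 : R -> R) (f : T -> R).
Let W y := Psi2 (phi (V y) / phi 1).
Hypothesis young : young_pair Psi1 Psi2.
Hypothesis mf : measurable_fun [set: T] f.
Hypothesis wf : (wnorm W f < +oo)%E.

Let phiV_ge1 y : 1 <= phi (V y) / phi 1.
Proof. by rewrite ler_pdivlMr// mul1r phi_le. Qed.

Let W_gt0 y : 0 < W y.
Proof. by have [_ _ /(_ _ (in1y _ (phiV_ge1 y)))[]] := young. Qed.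

Let Psi1_gt0 t : 1 <= t -> 0 < Psi1 t.
Proof. by move=> t1; have [_ _ /(_ _ (in1y _ t1))[]] := young. Qed.

Let young_le t y : 1 <= t -> Psi1 t * W y <= t + phi (V y) / phi 1.
Proof.
by move=> t1; have [_ _ _] := young; apply; [exact: in1y|exact/in1y/phiV_ge1].
Qed.

Let wnorm_ge (y : T) : ((`|f y| / W y)%:E <= wnorm W f)%E.
Proof. by apply: ereal_sup_ubound; exists y. Qed.

Lemma wnorm_fin_num : T -> wnorm W f \is a fin_num.
Proof.
move=> y; rewrite ge0_fin_numE//; apply: le_trans (wnorm_ge y).
by rewrite lee_fin; apply: divr_ge0 => //; exact: ltW.
Qed.

Let w := fine (wnorm W f).

Let w_ge0 : T -> 0 <= w.
Proof.
move=> y; rewrite -lee_fin fineK ?wnorm_fin_num//; apply: le_trans (wnorm_ge y).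
by rewrite lee_fin; apply: divr_ge0 => //; exact: ltW.
Qed.

Let f_le y : `|f y| <= w * W y.
Proof.
by rewrite -ler_pdivrMr ?W_gt0// -lee_fin fineK ?wnorm_fin_num.
Qed.

Let dominated_f : T -> dominated V f.
Proof.
move=> y0; split=> //; have [K K0 lipK] := phi_lipschitz.
have p1 := Psi1_gt0 _ (lexx 1); have w0 := w_ge0 y0.
exists (w / Psi1 1 * (1 + (phi 1 + K) / phi 1)) => [|y].
  apply: mulr_ge0; first by apply: divr_ge0 => //; exact: ltW.
  by apply: addr_ge0 => //; apply: divr_ge0; [apply: addr_ge0 => //|]; exact: ltW.
apply: le_trans (f_le y) _; rewrite -!mulrA; apply: ler_wpM2l => //.
rewrite ler_pdivlMl//; apply: le_trans (young_le _ _ (lexx 1)) _.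
have V1 := V_ge1 y; rewrite mulrDl mul1r lerD//.
rewrite mulrAC ler_pM2r ?invr_gt0//.
have := lipK 1 (V y) (lexx 1) V1.
have : phi 1 <= phi 1 * V y by apply: ler_peMr => //; exact: ltW.
lra.
Qed.

(** Choosing the signs of [a] as those of the differences turns the bound on
    the signed weighted sum into a bound on the sum of absolute values. *)
Lemma weighted_series_le x x' :
  (\sum_(0 <= n <oo) (Psi1 (r n))%:E *
      `|\int[kprod P n x]_y (f y)%:E - \int[kprod P n x']_y (f y)%:E|
   <= (fine (cbound phi bV cV eb enu) * (V x + V x' - 1))%:E * wnorm W f)%E.
Proof.
have w0 := w_ge0 x; have df := dominated_f x.
have PV_le k z : (1 <= k)%N -> (\int[P k z]_y (V y)%:E <= (V z + bV)%:E)%E.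
  move=> k1; apply: le_trans (drift k z k1) _; rewrite lee_fin.
  have p0 := phi_gt0 _ (V_ge1 z); have b0 := bV_ge0.
  by rewrite indicE; case: (z \in C) => /=; lra.
pose D n := \int[kprod P n x]_y f y - \int[kprod P n x']_y f y.
have termE n : ((Psi1 (r n))%:E *
    `|\int[kprod P n x]_y (f y)%:E - \int[kprod P n x']_y (f y)%:E|)%E =
    (Psi1 (r n) * `|D n|)%:E.
  have fin z : (\int[kprod P n z]_y (f y)%:E)%E \is a fin_num.
    apply: integrable_fin_num => //; apply: dominated_integrable df => //.
    exact: (kprod_integrable_V P V bV).
  by rewrite -(fineK (fin x)) -(fineK (fin x')) EFinM.
have psi0 n : 0 < Psi1 (r n) by apply/Psi1_gt0/rate_ge1.
have term0 n : 0 <= Psi1 (r n) * `|D n| by apply: mulr_ge0 => //; exact: ltW.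
under eq_eseriesr do rewrite termE.
rewrite -(fineK (wnorm_fin_num x)) -EFinM -/w.
apply: lime_le; first by apply: is_cvg_nneseries => n _ _; rewrite lee_fin.
near=> N; rewrite sumEFin lee_fin.
pose a n := Psi1 (r n) * Num.sg (D n).
have -> : \sum_(0 <= n < N) Psi1 (r n) * `|D n| = \sum_(0 <= n < N) a n * D n.
  by apply: eq_bigr => n _; rewrite normrEsg mulrA.
have hf k y y' : a k * (f y - f y') <= w * stage k (V y) (V y').
  apply: le_trans (ler_norm _) _; rewrite normrM.
  have na : `|a k| <= Psi1 (r k).
    rewrite normrM (gtr0_norm (psi0 k)) ler_piMr//; first exact: ltW.
    by rewrite normr_sg lern1 leq_b1.
  apply: (@le_trans _ _ (Psi1 (r k) * (w * W y + w * W y'))).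
    apply: ler_pM => //; apply: le_trans (ler_normB _ _) _.
    by rewrite lerD.
  have y1 := young_le _ y (rate_ge1 k); have y2 := young_le _ y' (rate_ge1 k).
  rewrite -mulrDr mulrCA; apply: ler_wpM2l => //; lra.
have := weighted_sum_le P C V nu mV V_ge1 drift minor outC inC a f w x x' N df w0 hf.
move=> /le_trans; apply; rewrite [X in _ <= X]mulrC; apply: ler_wpM2l => //.
apply: potential0_cbound.
by have := V_ge1 x; have := V_ge1 x'; lra.
Unshelve. all: end_near. Qed.

End weighted_series.

End potential.
End rate_sequence.
End drift_rate.

(** * The theorem *)

(** V cannot decrease in mean by a fixed amount everywhere: at a point where V
    is within [eta] of its infimum it would fall below it. So C is nonempty
    and [bV] is nonnegative, facts that are left implicit in the hypotheses of
    the theorem. *)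
Lemma drift_forces_small_set {d} {T : measurableType d} {R : realType}
    (P : T -> {measure set T -> \bar R}) (C : set T) (V phi : T -> R) (bV eta : R) :
  (forall x, P x [set: T] = 1%E) -> T ->
  measurable_fun [set: T] V -> (forall x, 1 <= V x) ->
  0 < eta -> (forall x, eta <= phi x) ->
  (forall x, (\int[P x]_y (V y)%:E <= (V x - phi x + bV * \1_C x)%:E)%E) ->
  (exists x, C x) /\ 0 <= bV.
Proof.
move=> mass x0 mV V1 eta0 phi_eta drift.
have hinf : has_inf (range V).
  by split; [exists (V x0), x0|exists 1 => _ [x _ <-]].
have [_ [x _ <-] hx] := inf_adherent eta0 hinf.
have iV : (P x).-integrable [set: T] (EFin \o V) by exact: integrable_V_of_le (drift x).
have h1 : inf (range V) <= \int[P x]_y V y.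
  by apply: Rintegral_ge => // y; apply: ge_inf; [exact: hinf.2|exists y].
have h2 : \int[P x]_y V y <= V x - phi x + bV * \1_C x.
  by rewrite -lee_fin fineK//; exact: integrable_fin_num.
have h3 : 0 < bV * \1_C x by have := phi_eta x; lra.
have Cx : C x.
  apply: contrapT => nC; move: h3; rewrite indicE memNset//= mulr0 ltxx//.
split; first by exists x.
by move: h3; rewrite indicE mem_set//= mulr1 => /ltW.
Qed.

Theorem theorem3 (R : realType) :
  exists c : (R -> R) -> R -> R -> R -> R -> R,
  forall (d : measure_display) (T : measurableType d)
    (P : nat -> R.-pker T ~> T) (C : set T) (V : T -> R) (phi : R -> R)
    (nu : nat -> probability T R) (enu eb bV cV : R),
  measurable C ->
  measurable_fun [set: T] V ->
  (forall x, 1 <= V x) ->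
  concave_1y phi ->
  {in `[1, +oo[ &, {homo phi : s t / s <= t}} ->
  differentiable_1y phi ->
  {in `[1, +oo[, forall t, 0 < phi t} ->
  derive1 phi t @[t --> +oo] --> 0 ->
  0 < enu < 1 ->
  0 < eb < 1 ->
  (forall k x, (1 <= k)%N ->
    (\int[P k x]_y (V y)%:E <= (V x - phi (V x) + bV * \1_C x)%:E)%E) ->
  (forall k x A, (1 <= k)%N -> C x -> measurable A ->
    (enu%:E * nu k A <= P k x A)%E) ->
  ((bV * (1 - eb)^-1)%:E <= ereal_inf [set (phi (V x))%:E | x in ~` C])%E ->
  (ereal_sup [set (V x)%:E | x in C] <= cV%:E)%E ->
  [/\ 0 <= c phi bV cV eb enu,
      (c phi bV cV eb enu)%:E = cbound phi bV cV eb enu &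
      forall (Psi1 Psi2 : R -> R) (f : T -> R) (x x' : T),
        let W := fun y => Psi2 (phi (V y) / phi 1) in
        young_pair Psi1 Psi2 ->
        measurable_fun [set: T] f ->
        (wnorm W f < +oo)%E ->
        (\sum_(0 <= n <oo)
            (Psi1 (rate phi eb n))%:E *
            `|\int[kprod P n x]_y (f y)%:E - \int[kprod P n x']_y (f y)%:E|
         <= (c phi bV cV eb enu * (V x + V x' - 1))%:E * wnorm W f)%E].
Proof.
exists (fun phi bV cV eb enu => fine (cbound phi bV cV eb enu)).
move=> d T P C V phi nu enu eb bV cV mC mV V1 phic phim phid phi0 phi'0.
move=> /andP[enu0 enu1] /andP[eb0 eb1] drift minor infC supC.
have [x0] : inhabited T.
  apply: contrapT => T0; have : nu 0 [set: T] = 0%E.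
    rewrite (_ : [set: T] = set0) ?measure0//.
    by apply/seteqP; split=> // x _; apply: T0.
  by rewrite probability_setT => /eqP; rewrite onee_eq0.
have phiV x : phi 1 <= phi (V x).
  by apply: phim; rewrite ?in_itv/= ?lexx ?V1.
have phi1 : 0 < phi 1 by apply: phi0; rewrite in_itv/= lexx.
have [[xC CxC] bV0] := drift_forces_small_set (P 1) C V (phi \o V) bV (phi 1)
  (fun x => prob_kernel x) x0 mV V1 phi1 phiV (fun x => drift 1 x isT).
have outC x : ~ C x -> bV <= (1 - eb) * phi (V x).
  move=> nCx; rewrite -ler_pdivrMl ?subr_gt0// mulrC -lee_fin.
  by apply: le_trans infC _; apply: ereal_inf_lbound; exists x.
have inC x : C x -> V x <= cV.
  move=> Cx; rewrite -lee_fin; apply: le_trans supC.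
  by apply: ereal_sup_ubound; exists x.
have cV1 : 1 <= cV by apply: le_trans (V1 xC) (inC _ CxC).
split.
- exact: cbound_ge0.
- by rewrite cboundE.
- move=> Psi1 Psi2 f x x' W young mf wf.
  exact: (weighted_series_le phi phic phim phid phi0 eb eb0 eb1 bV cV enu
    enu0 enu1 bV0 cV1 phi'0 P C V nu mV V1 drift minor outC inC Psi1 Psi2 f young mf wf).
Qed.
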